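(* Let $f:\mathbb{R}^n\to\mathbb{R}$ be convex and $L$-smooth, with stochastic gradients satisfying $\mathbb{E}_\xi[\nabla f(x,\xi)]=\nabla f(x)$ and $\mathbb{E}_\xi[\|\nabla f(x,\xi)-\nabla f(x)\|_2^2]\le\sigma^2$ for all $x\in\mathbb{R}^n$. Let $x^*$ be a minimizer of $f$, $R_0=\|x^0-x^*\|_2$, $C=\sqrt5$, and let $\beta\in(0,1)$ and $N\ge1$ be such that $\ln\frac{4N}{\beta}\ge2$. Consider $N$ iterations of clipped-SSTM started at $x^0$ with $B=\frac{CR_0}{8\ln\frac{4N}{\beta}}$, $$a=\max\left\{a',\frac{\sigma N^{3/2}}{LR_0}\sqrt{\ln\frac{4N}{\beta}}\right\},\quad a'=\max\left\{1,\frac{16\ln\frac{4N}{\beta}}{C},36\left(2\ln\frac{4N}{\beta}+\sqrt{4\ln^2\frac{4N}{\beta}+2\ln\frac{4N}{\beta}}\right)^2\right\},$$ $$m_k=\max\left\{1,\frac{6000\sigma^2\alpha_{k+1}^2N\ln\frac{4N}{\beta}}{C^2R_0^2},\frac{10368\sigma^2\alpha_{k+1}^2N}{C^2R_0^2}\right\}.$$ Then clipped-SSTM achieves $f(y^N)-f(x^* )\le\varepsilon$ with probability at least $1-\beta$ after $$O\left(\max\left\{\sqrt{\frac{LR_0^2}{\varepsilon}},\frac{\sigma^2R_0^2}{\varepsilon^2}\right\}\ln\frac{LR_0^2+\sigma R_0}{\varepsilon\beta}\right)$$ iterations/oracle calls.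
   Context: Problem: minimize $f(x)=\mathbb{E}_\xi[f(x,\xi)]$ over $x\in\mathbb{R}^n$; a minimizer $x^*$ is assumed to exist. $f$ is accessed only through stochastic gradients $\nabla f(x,\xi)$; $\sigma\ge0$; nothing is assumed about their distribution beyond unbiasedness and variance at most $\sigma^2$. One oracle call is one sample of $\nabla f(x,\xi)$. $\varepsilon>0$ is the target accuracy. $f$ is $L$-smooth ($L>0$) if it is differentiable and $\|\nabla f(x)-\nabla f(y)\|_2\le L\|x-y\|_2$ for all $x,y\in\mathbb{R}^n$. Clipping: $\mathrm{clip}(g,\lambda)=\min\{1,\lambda/\|g\|_2\}\,g$. Algorithm clipped-SSTM. Inputs: starting point $x^0$, number of iterations $N$, batchsizes $m_0,\dots,m_{N-1}$, stepsize parameter $a$, clipping parameter $B$. Set $A_0=\alpha_0=0$, $y^0=z^0=x^0$. For $k=0,\dots,N-1$: set $\alpha_{k+1}=\frac{k+2}{2aL}$, $A_{k+1}=A_k+\alpha_{k+1}$, $\lambda_{k+1}=\frac{B}{\alpha_{k+1}}$; $x^{k+1}=(A_ky^k+\alpha_{k+1}z^k)/A_{k+1}$; draw fresh i.i.d. samples $\xi^k_1,\dots,\xi^k_{m_k}$ and compute $\nabla f(x^{k+1},\boldsymbol{\xi}^k)=\frac1{m_k}\sum_{i=1}^{m_k}\nabla f(x^{k+1},\xi_i^k)$; compute $\widetilde\nabla f(x^{k+1},\boldsymbol{\xi}^k)=\mathrm{clip}(\nabla f(x^{k+1},\boldsymbol{\xi}^k),\lambda_{k+1})$; $z^{k+1}=z^k-\alpha_{k+1}\widetilde\nabla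 f(x^{k+1},\boldsymbol{\xi}^k)$; $y^{k+1}=(A_ky^k+\alpha_{k+1}z^{k+1})/A_{k+1}$. Output: $y^N$. $O(\cdot)$ hides absolute numerical constants.
   Formalization: The O(X) bound on iterations and oracle calls is stated as O(max{1, X}): at least one iteration is needed, yet X is zero or negative for large ε (for instance X = 0 when σ = 0 and LR_0^2 = εβ). *)

(* Defs.v *)
From mathcomp Require Import all_boot all_order all_algebra.
From mathcomp Require Import all_classical all_reals all_analysis.

Set Implicit Arguments.
Unset Strict Implicit.
Unset Printing Implicit Defensive.

Import Order.TTheory GRing.Theory Num.Theory.
Import numFieldNormedType.Exports.

Local Open Scope classical_set_scope.
Local Open Scope ring_scope.

(* The library norm on 'rV[R]_n is the sup norm; it induces the same topology,
   hence the same notion of (Frechet) differentiability. *)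
Definition norm2 (R : realType) (n : nat) (x : 'rV[R]_n) : R :=
  Num.sqrt (\sum_(j < n) x 0 j ^+ 2).

Definition grad (R : realType) (n : nat) (f : 'rV[R]_n -> R) (x : 'rV[R]_n) :
    'rV[R]_n :=
  \row_j ('D_(delta_mx 0 j) f x).

Definition smooth (R : realType) (n : nat) (f : 'rV[R]_n -> R) (L : R) : Prop :=
  (forall x, differentiable f x) /\
  (forall x y, norm2 (grad f x - grad f y) <= L * norm2 (x - y)).

Definition minimizer (R : realType) (n : nat) (f : 'rV[R]_n -> R)
    (xstar : 'rV[R]_n) : Prop :=
  forall y, f xstar <= f y.

(* [G x xi] is the stochastic gradient at [x] for the sample [xi] of law [D].
   Joint measurability is stated through n.-tuple R, whose sigma-algebra is
   generated by the coordinates, i.e. is the Borel sigma-algebra of R^n.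
   Since 'E_D is \bar R-valued and +oo - +oo evaluates to -oo, the equation for
   the mean includes the integrability of each coordinate of [G x]. *)
Definition stochastic_gradient (R : realType) (n : nat) (d : measure_display)
    (Xi : measurableType d) (D : probability Xi R) (f : 'rV[R]_n -> R)
    (sigma : R) (G : 'rV[R]_n -> Xi -> 'rV[R]_n) : Prop :=
  [/\ forall j : 'I_n, measurable_fun [set: n.-tuple R * Xi]
        (fun p : n.-tuple R * Xi => G (\row_i tnth p.1 i) p.2 0 j),
      forall x (j : 'I_n), ('E_D[fun xi => (G x xi 0 j)%R] = (grad f x 0 j)%:E)%E
    & forall x,
        ('E_D[fun xi => (norm2 (G x xi - grad f x) ^+ 2)%R] <= (sigma ^+ 2)%:E)%E].

Definition mutually_independent (R : realType) (d d' : measure_display)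
    (Omega : measurableType d) (S : measurableType d') (P : probability Omega R)
    (I : eqType) (idx : set I) (X : I -> Omega -> S) : Prop :=
  forall J : seq I, uniq J -> (forall i, i \in J -> idx i) ->
  forall A : I -> set S, (forall i, measurable (A i)) ->
    P [set w | forall i, i \in J -> A i (X i w)]
    = (\prod_(i <- J) P (X i @^-1` A i))%E.

Definition iid_samples (R : realType) (d d' : measure_display)
    (Omega : measurableType d) (S : measurableType d') (P : probability Omega R)
    (D : probability S R) (I : eqType) (idx : set I)
    (X : I -> Omega -> S) : Prop :=
  [/\ forall i, idx i -> measurable_fun setT (X i),
      forall i, idx i -> forall A, measurable A -> P (X i @^-1` A) = D A
    & mutually_independent P idx X].

Definition clip (R : realType) (n : nat) (g : 'rV[R]_n) (lambda : R) :
    'rV[R]_n :=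
  Num.min 1 (lambda / norm2 g) *: g.

Definition minibatch (R : realType) (n : nat) (Xi : Type)
    (G : 'rV[R]_n -> Xi -> 'rV[R]_n) (x : 'rV[R]_n) (xi : nat -> Xi) (m : nat) :
    'rV[R]_n :=
  m%:R^-1 *: \sum_(i < m) G x (xi i).

Definition alpha (R : realType) (a L : R) (k : nat) : R :=
  if k is j.+1 then j.+2%:R / (2 * a * L) else 0.

Fixpoint Aseq (R : realType) (a L : R) (k : nat) : R :=
  if k is j.+1 then Aseq a L j + alpha a L j.+1 else 0.

(* The pair (y^k, z^k), as a function of the samples: [xi k i] is the i-th
   sample (counted from 0) drawn at iteration k. *)
Fixpoint clipped_SSTM (R : realType) (n : nat) (Xi : Type)
    (G : 'rV[R]_n -> Xi -> 'rV[R]_n) (L a B : R) (m : nat -> nat)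
    (x0 : 'rV[R]_n) (xi : nat -> nat -> Xi) (k : nat) : 'rV[R]_n * 'rV[R]_n :=
  if k is j.+1 then
    let: (y, z) := clipped_SSTM G L a B m x0 xi j in
    let al := alpha a L j.+1 in
    let lambda := B / al in
    let x := (Aseq a L j.+1)^-1 *: (Aseq a L j *: y + al *: z) in
    let g := clip (minibatch G x (xi j) (m j)) lambda in
    let z' := z - al *: g in
    let y' := (Aseq a L j.+1)^-1 *: (Aseq a L j *: y + al *: z') in
    (y', z')
  else (x0, x0).

Definition Cconst (R : realType) : R := Num.sqrt 5.

Definition logfactor (R : realType) (beta : R) (N : nat) : R :=
  ln (4 * N%:R / beta).

Definition clip_param (R : realType) (R0 beta : R) (N : nat) : R :=
  Cconst R * R0 / (8 * logfactor beta N).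

Definition step_param' (R : realType) (beta : R) (N : nat) : R :=
  let l := logfactor beta N in
  Num.max 1 (Num.max (16 * l / Cconst R)
    (36 * (2 * l + Num.sqrt (4 * l ^+ 2 + 2 * l)) ^+ 2)).

Definition step_param (R : realType) (L sigma R0 beta : R) (N : nat) : R :=
  Num.max (step_param' beta N)
    (sigma * (N%:R `^ (3 / 2)) / (L * R0) * Num.sqrt (logfactor beta N)).

(* Batchsizes are integers: the real-valued formula is rounded up. *)
Definition batchsize (R : realType) (L sigma R0 beta : R) (N k : nat) : nat :=
  let al := alpha (step_param L sigma R0 beta N) L k.+1 in
  let l := logfactor beta N in
  let C := Cconst R in
  absz (Num.ceil (Num.max 1 (Num.max
       (6000 * sigma ^+ 2 * al ^+ 2 * N%:R * l / (C ^+ 2 * R0 ^+ 2))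
       (10368 * sigma ^+ 2 * al ^+ 2 * N%:R / (C ^+ 2 * R0 ^+ 2))))).

Definition sample_indices (R : realType) (L sigma R0 beta : R) (N : nat) :
    set (nat * nat) :=
  [set p | (p.1 < N)%N /\ (p.2 < batchsize L sigma R0 beta N p.1)%N].

Definition oracle_calls (R : realType) (L sigma R0 beta : R) (N : nat) : nat :=
  (\sum_(k < N) batchsize L sigma R0 beta N k)%N.

Definition SSTM_output (R : realType) (n : nat) (Xi : Type)
    (G : 'rV[R]_n -> Xi -> 'rV[R]_n) (L sigma R0 beta : R) (N : nat)
    (x0 : 'rV[R]_n) (xi : nat -> nat -> Xi) : 'rV[R]_n :=
  (clipped_SSTM G L (step_param L sigma R0 beta N) (clip_param R0 beta N)
     (batchsize L sigma R0 beta N) x0 xi N).1.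

Definition complexity (R : realType) (L sigma R0 eps beta : R) : R :=
  Num.max (Num.sqrt (L * R0 ^+ 2 / eps)) (sigma ^+ 2 * R0 ^+ 2 / eps ^+ 2)
  * ln ((L * R0 ^+ 2 + sigma * R0) / (eps * beta)).

(* Main.v *)
From HB Require Import structures.
Require Import Defs.
From mathcomp Require Import all_boot all_order all_algebra.
From mathcomp Require Import all_classical all_reals all_analysis.
From mathcomp Require Import measurable_realfun ring lra.
From mathcomp Require unstable.
Import Order.TTheory GRing.Theory Num.Theory.
Import numFieldNormedType.Exports.
Local Open Scope classical_set_scope.
Local Open Scope ring_scope.
Set Implicit Arguments.
Unset Strict Implicit.
Unset Printing Implicit Defensive.

(* The potential V_k = A_k (f(y_k) - f( x* )) + |z_k - x*|^2 / 2 satisfies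
     V_(k+1) <= V_k + alpha <theta, x* - z_k> + alpha^2 |theta|^2,
   where theta is the error of the clipped minibatch gradient.  Write
   l = ln (4 N / beta), R^2 = 5 R0^2, and eta for the error of the minibatch
   gradient before clipping.  As long as V_k <= R^2 / 2 and y_k stays in the ball
   of radius R, the true gradient is at most half the clipping level; then
   |theta| <= |eta|, the clipping bias is at most |eta|^2 / (2 lambda), and with
   tau = (3/4) l / R0^2 the exponential exp (tau (V_(k+1) - V_k)) is at most
     1 + tau alpha <eta, x* - z_k> + 12 (l / R0)^2 alpha^2 |eta|^2.
   The expectation of this quadratic is at most 1 + l / (100 N) by the choice of
   the batchsizes.  So exp (tau (V_k - R^2 / 2)), replaced by 1 once the
   iterates leave the good region, gains at most this factor per iteration; its
   initial value is exp (- 3 l / 2), whence P (V_N > R^2 / 2) <= exp (- l)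
   <= beta.  No stopping time is needed because the replaced value 1 is an upper
   bound at every step. *)

(** * Euclidean geometry and clipping *)

(** The noise has only a second moment, so exponentials of eta need not be integrable. Clipping
    bounds the exponent, a bounded exponent is dominated by a quadratic, and the quadratic needs
    nothing beyond the variance. The linear term must be carried by eta and not by theta, because
    clipping destroys the zero mean; the price is a bias that is of second order only while the true
    gradient stays within half the clipping level.

    Minibatches are unrolled into single samples: the variance of the samples still to come is kept
    as a deterministic term, so independence is only used between one sample and the past, through
    Tonelli.

    For the complexity, the requirement is 100 u l <= N, with u the larger of sqrt (L R0^2 / eps)
    and (sigma R0 / eps)^2. It is implicit, as l contains N, and solving it yields ln (u / beta)
    where the statement has ln ((L R0^2 + sigma R0) / (eps beta)); comparing the two logarithms
    takes a separate argument. The second term of a keeps every batch below a constant, so oracle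
    calls and iterations are of the same order. *)

Definition dot (R : realType) (n : nat) (x y : 'rV[R]_n) : R :=
  \sum_(j < n) x 0 j * y 0 j.

Section Dot.
Context {R : realType} {n : nat}.
Implicit Types x y z v g : 'rV[R]_n.

Lemma dotC x y : dot x y = dot y x.
Proof. by apply: eq_bigr => j _; rewrite mulrC. Qed.

Lemma dotDl x y z : dot (x + y) z = dot x z + dot y z.
Proof. by rewrite -big_split; apply: eq_bigr => j _ /=; rewrite mxE mulrDl. Qed.

Lemma dotZl (c : R) x z : dot (c *: x) z = c * dot x z.
Proof. by rewrite mulr_sumr; apply: eq_bigr => j _ /=; rewrite mxE mulrA. Qed.

Lemma dotNl x z : dot (- x) z = - dot x z.
Proof. by rewrite -scaleN1r dotZl mulN1r. Qed.

Lemma dotDr x y z : dot z (x + y) = dot z x + dot z y.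
Proof. by rewrite dotC dotDl !(dotC z). Qed.

Lemma dotZr (c : R) x z : dot z (c *: x) = c * dot z x.
Proof. by rewrite dotC dotZl (dotC z). Qed.

Lemma dotNr x z : dot z (- x) = - dot z x.
Proof. by rewrite dotC dotNl (dotC z). Qed.

Definition dotE := (dotDl, dotDr, dotNl, dotNr, dotZl, dotZr).

Lemma dot_ge0 x : 0 <= dot x x.
Proof. by apply: sumr_ge0 => j _; rewrite -expr2 sqr_ge0. Qed.

Lemma norm2_ge0 x : 0 <= norm2 x.
Proof. exact: sqrtr_ge0. Qed.

Lemma sqr_norm2 x : norm2 x ^+ 2 = dot x x.
Proof.
rewrite sqr_sqrtr; first by apply: eq_bigr => j _; rewrite expr2.
by apply: sumr_ge0 => j _; exact: sqr_ge0.
Qed.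

Lemma norm2_le x (r : R) : 0 <= r -> dot x x <= r ^+ 2 -> norm2 x <= r.
Proof.
by move=> r0; rewrite -sqr_norm2 ler_pXn2r// nnegrE ?norm2_ge0.
Qed.

Lemma dot_le x y : dot x y <= norm2 x * norm2 y.
Proof.
have [y0|y0] := eqVneq (dot y y) 0.
  have : dot x y = 0.
    apply: big1 => j _.
    have /eqP : y 0 j * y 0 j = 0.
      move/eqP: y0; rewrite psumr_eq0 => [|i _]; last by rewrite -expr2 sqr_ge0.
      by move/allP => /(_ j (mem_index_enum _)) /eqP.
    by rewrite mulf_eq0 orbb => /eqP ->; rewrite mulr0.
  by move=> ->; rewrite mulr_ge0 ?norm2_ge0.
apply: le_trans (ler_norm _) _; rewrite -ler_sqr ?nnegrE//; last first.
  by rewrite mulr_ge0 ?norm2_ge0.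
rewrite real_normK ?num_real// exprMn !sqr_norm2.
have y1 : 0 < dot y y by rewrite lt_neqAle eq_sym y0 dot_ge0.
have := dot_ge0 (dot y y *: x - dot x y *: y).
rewrite !dotE (dotC y x) => h.
have : 0 <= dot y y * (dot x x * dot y y - dot x y ^+ 2) by lra.
by rewrite pmulr_rge0// subr_ge0.
Qed.

Lemma norm2N x : norm2 (- x) = norm2 x.
Proof.
by congr Num.sqrt; apply: eq_bigr => j _; rewrite mxE sqrrN.
Qed.

Lemma dot_ge x y : - (norm2 x * norm2 y) <= dot x y.
Proof.
rewrite lerNl -dotNl; apply: le_trans (dot_le _ _) _.
by rewrite norm2N.
Qed.

Lemma norm2D x y : norm2 (x + y) <= norm2 x + norm2 y.
Proof.
apply: norm2_le; first by rewrite addr_ge0 ?norm2_ge0.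
rewrite !dotE -!sqr_norm2 (dotC y x); have := dot_le x y; nra.
Qed.

Lemma norm2Z (c : R) x : norm2 (c *: x) = `|c| * norm2 x.
Proof.
rewrite /norm2 -(sqrtr_sqr c) -sqrtrM ?sqr_ge0//; congr Num.sqrt.
by rewrite mulr_sumr; apply: eq_bigr => j _; rewrite mxE exprMn.
Qed.

Lemma norm2_convex_le x y (r s t : R) : 0 <= s -> 0 <= t ->
  norm2 x <= r -> norm2 y <= r -> norm2 (s *: x + t *: y) <= (s + t) * r.
Proof.
move=> s0 t0 xr yr; apply: le_trans (norm2D _ _) _.
by rewrite !norm2Z !ger0_norm// mulrDl lerD// ler_wpM2l.
Qed.

Section Clip.
Variables (g v : 'rV[R]_n) (lam : R).
Hypotheses (lam0 : 0 < lam).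

Let clip_case : (clip g lam = g) \/ (lam < norm2 g /\ clip g lam = (lam / norm2 g) *: g).
Proof.
rewrite /clip; have [g0|g0] := eqVneq (norm2 g) 0.
  (* Division by zero gives 0, so at [g = 0] the clipping factor is 0 and not 1; the result is still
     [g]. *)
  left; rewrite g0 invr0 mulr0 min_r ?ler01// scale0r.
  apply/esym/rowP => j; rewrite mxE; apply/eqP; rewrite -sqrf_eq0.
  move/eqP: g0; rewrite -sqrf_eq0 sqr_norm2 psumr_eq0 => [|i _]; last first.
    by rewrite -expr2 sqr_ge0.
  by move/allP => /(_ j (mem_index_enum _)); rewrite -expr2.
have g1 : 0 < norm2 g by rewrite lt_neqAle eq_sym g0 norm2_ge0.
have [h|h] := leP (norm2 g) lam.
  by left; rewrite min_l ?scale1r// ler_pdivlMr// mul1r.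
right; split=> //; rewrite min_r// ler_pdivrMr// mul1r; exact: ltW.
Qed.

Lemma norm2_clip : norm2 (clip g lam) <= lam.
Proof.
rewrite /clip norm2Z ger0_norm; last first.
  by rewrite le_min ler01 divr_ge0 ?norm2_ge0 ?ltW.
have [->|g0] := eqVneq (norm2 g) 0; first by rewrite mulr0 ltW.
have g1 : 0 < norm2 g by rewrite lt_neqAle eq_sym g0 norm2_ge0.
by rewrite -ler_pdivlMr// ge_min lexx orbT.
Qed.

Hypothesis vlam : norm2 v <= lam / 2.

(* As [|v| <= lam / 2], clipping moves [g] by [|g| - lam <= |g - v| - lam / 2],
   which AM-GM bounds by [|g - v|^2 / (2 lam)]. *)
Lemma clip_bias : norm2 (clip g lam - g) <= norm2 (g - v) ^+ 2 / (2 * lam).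
Proof.
case: clip_case => [->|[lg ->]].
  rewrite subrr -[X in norm2 X](scale0r g) norm2Z normr0 mul0r.
  by rewrite divr_ge0 ?sqr_ge0// mulr_ge0 ?ltW.
have g1 : 0 < norm2 g by exact: lt_trans lg.
have -> : (lam / norm2 g) *: g - g = (lam / norm2 g - 1) *: g.
  by rewrite scalerBl scale1r.
rewrite norm2Z ler0_norm; last first.
  by rewrite subr_le0 ler_pdivrMr// mul1r ltW.
rewrite opprB mulrBl mul1r divfK ?gt_eqF//.
have h1 : norm2 g <= norm2 (g - v) + norm2 v.
  by rewrite -{1}[g](subrK v) norm2D.
rewrite ler_pdivlMr ?mulr_gt0//.
have : 0 <= (norm2 (g - v) - lam) ^+ 2 by exact: sqr_ge0.
have h2 : norm2 g <= norm2 (g - v) + lam / 2.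
  by rewrite (le_trans h1)// lerD2l.
have : 0 <= (norm2 (g - v) + lam / 2 - norm2 g) * lam.
  by rewrite mulr_ge0 ?subr_ge0// ltW.
lra.
Qed.

(** Clipping is the projection onto the ball of radius [lam], which contains [v]. The computation
    factors [1 - s] out of the difference of the two squares. *)
Lemma clip_contract : dot (clip g lam - v) (clip g lam - v) <= dot (g - v) (g - v).
Proof.
case: clip_case => [->//|[lg ->]].
have g1 : 0 < norm2 g by exact: lt_trans lg.
set s := lam / norm2 g.
have s0 : 0 <= s by rewrite divr_ge0 ?ltW.
have s1 : s <= 1 by rewrite ler_pdivrMr// mul1r ltW.
have sg : s * norm2 g = lam by rewrite divfK ?gt_eqF.
rewrite !dotE -!sqr_norm2 (dotC v g).
have h := dot_le g v; have v0 := norm2_ge0 v.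
suff : 0 <= (1 - s) * ((1 + s) * norm2 g ^+ 2 - 2 * dot g v) by nra.
apply: mulr_ge0; first by rewrite subr_ge0.
have : norm2 g * norm2 v <= norm2 g * (lam / 2) by rewrite ler_wpM2l// ltW.
nra.
Qed.

Lemma clip_dist : norm2 (clip g lam - v) <= 3 / 2 * lam.
Proof.
apply: le_trans (norm2D _ _) _; rewrite norm2N.
have := norm2_clip; have := vlam; lra.
Qed.

End Clip.
End Dot.

(** * Smooth convex functions *)

Section Smooth.
Context {R : realType} {n : nat}.
Variables (f : 'rV[R]_n -> R) (L : R).

Lemma diff_grad x (d : 'rV[R]_n) : differentiable f x -> 'd f x d = dot (grad f x) d.
Proof.
move=> df; rewrite {1}[d]row_sum_delta linear_sum; apply: eq_bigr => j _.
by rewrite linearZ /= mxE deriveE// mulrC.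
Qed.

Lemma is_derive_line x (d : 'rV[R]_n) (t : R) : (forall y, differentiable f y) ->
  is_derive t 1 (fun s : R => f (x + s *: d)) (dot (grad f (x + t *: d)) d).
Proof.
move=> df.
have dg : is_diff t (fun s : R => x + s *: d) (0 + ( *:%R ^~ d : R -> _)).
  exact: is_diffD.
have dg' : differentiable (fun s : R => x + s *: d) t by case: dg.
have dfg : differentiable (f \o (fun s : R => x + s *: d)) t.
  exact: differentiable_comp.
apply: DeriveDef; first exact/derivable1_diffP.
rewrite deriveE// diff_comp//.
case: dg => _ dgE; rewrite /= dgE /= diff_grad//.
by rewrite -[X in dot _ X]/(0 + 1 *: d) scale1r add0r.
Qed.

Hypothesis fL : smooth f L.
Hypothesis L0 : 0 <= L.

Let df x : differentiable f x. Proof. by have [] := fL. Qed.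

Lemma grad_line x (d : 'rV[R]_n) (t : R) : 0 <= t ->
  `|dot (grad f (x + t *: d)) d - dot (grad f x) d| <= L * t * dot d d.
Proof.
move=> t0; rewrite -dotNl -dotDl.
have h : norm2 (grad f (x + t *: d) - grad f x) * norm2 d <= L * t * dot d d.
  rewrite -sqr_norm2 expr2 mulrA ler_wpM2r ?norm2_ge0//.
  have [_ /(_ (x + t *: d) x)] := fL.
  by rewrite addrAC subrr add0r norm2Z ger0_norm// mulrA.
by rewrite ler_norml (le_trans (dot_le _ _) h) andbT (le_trans _ (dot_ge _ _))// lerN2.
Qed.

(** The claimed bound is subtracted from [f] along the segment; the Lipschitz gradient makes the
    difference nonincreasing, which avoids integrating the gradient. *)
Lemma descent x (d : 'rV[R]_n) : f (x + d) <= f x + dot (grad f x) d + L / 2 * dot d d.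
Proof.
pose h (s : R) := f (x + s *: d) - (s * dot (grad f x) d + s ^+ 2 * (L / 2 * dot d d)).
have dh (t : R) : is_derive t 1 h
    (dot (grad f (x + t *: d)) d - dot (grad f x) d - L * t * dot d d).
  have := is_derive_line x d t df => dl.
  by apply: is_derive_eq; rewrite /GRing.scale/=; lra.
suff : h 1 <= h 0 by rewrite /h !scale1r !scale0r addr0; lra.
apply: (@ler0_derive1_nincr _ h 0 1 _ _ _ 0 1 (lexx _) ler01 (lexx _)).
- by move=> t _; apply: ex_derive.
- move=> t /[!in_itv]/= /andP[t0 _]; rewrite derive1E derive_val subr_le0.
  by apply: le_trans (ler_norm _) _; apply: grad_line; exact: ltW.
- apply: derivable_within_continuous => t _; exact: ex_derive.
Qed.

Lemma descent_ge x (d : 'rV[R]_n) : f x + dot (grad f x) d - L / 2 * dot d d <= f (x + d).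
Proof.
pose h (s : R) := s * dot (grad f x) d - s ^+ 2 * (L / 2 * dot d d) - f (x + s *: d).
have dh (t : R) : is_derive t 1 h
    (dot (grad f x) d - dot (grad f (x + t *: d)) d - L * t * dot d d).
  have := is_derive_line x d t df => dl.
  by apply: is_derive_eq; rewrite /GRing.scale/=; lra.
suff : h 1 <= h 0 by rewrite /h !scale1r !scale0r addr0; lra.
apply: (@ler0_derive1_nincr _ h 0 1 _ _ _ 0 1 (lexx _) ler01 (lexx _)).
- by move=> t _; apply: ex_derive.
- move=> t /[!in_itv]/= /andP[t0 _]; rewrite derive1E derive_val subr_le0.
  by apply: le_trans (ler_norm _) _; rewrite distrC; apply: grad_line; exact: ltW.
- apply: derivable_within_continuous => t _; exact: ex_derive.
Qed.

(** Convexity bounds [f (x + t *: d)] above and [descent_ge] bounds it below. Dividing by [t] leaves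
    an error [t * q], made smaller than [e] by the choice of [t]; the denominator [q + 1] covers
    [q = 0]. *)
Lemma convex_grad x y : convex_function [set: convex_lmodType 'rV[R]_n] f ->
  f x + dot (grad f x) (y - x) <= f y.
Proof.
move=> cf; set d := y - x.
have key (t : R) : 0 < t <= 1 -> f x + dot (grad f x) d <= f y + t * (L / 2 * dot d d).
  move=> /andP[t0 t1].
  have ht : Itv.spec (@Itv.num_sem R) (Itv.Real `[0%Z, 1%Z]) t.
    by rewrite /Itv.num_sem /= num_real in_itv/= (ltW t0).
  have /(_ y x) := cf (Itv.mk ht); rewrite !inE => /(_ Logic.I Logic.I).
  have -> : (conv (Itv.mk ht) (y : convex_lmodType 'rV[R]_n) x) = x + t *: d.
    rewrite /conv/= /d /unstable.onem scalerBr scalerBl scale1r.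
    by rewrite addrC -addrA [- _ + _]addrC.
  have := descent_ge x (t *: d); rewrite !dotE.
  rewrite /conv/= /conv/= /GRing.scale/= /unstable.onem => h1 h2.
  rewrite -(ler_pM2l t0); nra.
apply/ler_addgt0Pr => e e0.
set q := L / 2 * dot d d; have q0 : 0 <= q by rewrite mulr_ge0 ?dot_ge0// divr_ge0.
have := key (Num.min 1 (e / (q + 1))).
have q1 : 0 < q + 1 by lra.
rewrite lt_min ltr01 divr_gt0//= ge_min lexx/= => /(_ isT) /le_trans; apply.
rewrite lerD2l; apply: (@le_trans _ _ (e / (q + 1) * q)).
  by rewrite ler_wpM2r// ge_min lexx orbT.
by rewrite -mulrAC ler_pdivrMr//; nra.
Qed.

(** A gradient step of length [L^-1] cannot go below the minimum. *)
Lemma sqr_grad_le x xstar : 0 < L -> minimizer f xstar ->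
  norm2 (grad f x) ^+ 2 <= 2 * L * (f x - f xstar).
Proof.
move=> L1 fmin; have := descent x (- L^-1 *: grad f x).
rewrite !dotE sqr_norm2 => h.
have := fmin (x + - L^-1 *: grad f x); move: h.
set q := dot _ _ => h1 h2.
have h3 : L / 2 * (- L^-1 * (- L^-1 * q)) = L^-1 * q / 2 by field; rewrite gt_eqF.
have h4 : L^-1 * q <= 2 * (f x - f xstar) by move: h1 h2; rewrite h3; nra.
have : L * (L^-1 * q) <= L * (2 * (f x - f xstar)) by rewrite ler_pM2l.
by rewrite mulVKf ?gt_eqF//; lra.
Qed.

End Smooth.

(** * One iteration of the accelerated method *)

Section OneStep.
Context {R : realType} {n : nat}.
Variables (f : 'rV[R]_n -> R) (L : R) (xstar : 'rV[R]_n).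
Hypotheses (L0 : 0 < L) (fL : smooth f L).
Hypothesis (cf : convex_function [set: convex_lmodType 'rV[R]_n] f).
Hypothesis (fmin : minimizer f xstar).

Definition potential (A : R) (y z : 'rV[R]_n) : R :=
  A * (f y - f xstar) + norm2 (z - xstar) ^+ 2 / 2.

(** One formula for two points of an iteration: the query point from the old [z], and the new [y]
    from the new [z]. *)
Definition coupling (A al : R) (y z : 'rV[R]_n) : 'rV[R]_n :=
  (A + al)^-1 *: (A *: y + al *: z).

(** The factor 2 in the condition on [al] leaves a negative multiple of the squared gradient, which
    absorbs the cross term between gradient and error. Hence the error terms involve [theta]
    alone. *)
Lemma potential_step (A al : R) (y z g : 'rV[R]_n) : 0 <= A -> 0 < al ->
  2 * (L * al ^+ 2) <= A + al ->
  let x := coupling A al y z in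
  let z' := z - al *: g in
  let theta := g - grad f x in
  potential (A + al) (coupling A al y z') z' <= potential A y z
    + (al * dot theta (xstar - z) + al ^+ 2 * dot theta theta).
Proof.
move=> A0 al0 hal; cbv zeta.
set x := coupling A al y z; set z' := z - al *: g; set theta := g - grad f x.
have A1 : 0 < A + al by rewrite ltr_wpDl.
have A1n : A + al != 0 by rewrite gt_eqF.
set v := grad f x.
have yE : coupling A al y z' = x + (- (al ^+ 2 / (A + al))) *: g.
  rewrite /x /coupling /z'; apply/rowP => j; rewrite !mxE; field => //.
have xE u : (A + al) * dot u x = A * dot u y + al * dot u z.
  by rewrite /x /coupling !dotE mulrA divff// mul1r.
have h1 := descent fL x ((- (al ^+ 2 / (A + al))) *: g).
have h2 := convex_grad fL (ltW L0) x y cf.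
have h3 := convex_grad fL (ltW L0) x xstar cf.
have gE : g = v + theta by rewrite /theta addrC subrK.
rewrite /potential yE !sqr_norm2 /z' {yE}; move: h1 h2 h3; rewrite -/v.
set p := al ^+ 2 / (A + al); set fy' := f (x + _).
have pE : (A + al) * p = al ^+ 2 by rewrite /p mulrC divfK.
clearbody fy' p theta v x; rewrite !dotE => h1 h2 h3.
have {}h1 := ler_wpM2l (ltW A1) h1.
have {}h2 := ler_wpM2l A0 h2.
have {}h3 := ler_wpM2l (ltW al0) h3.
have h4 : (A + al) * (L / 2 * (- p * (- p * dot g g))) <= al ^+ 2 / 4 * dot g g.
  rewrite [leLHS](_ : _ = (L * al ^+ 2 / 2 * p) * dot g g); last first.
    by rewrite -pE; field.
  rewrite ler_wpM2r ?dot_ge0// -(ler_pM2l A1).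
  rewrite [leLHS](_ : _ = L * al ^+ 2 / 2 * al ^+ 2); last by rewrite -pE; ring.
  by have := sqr_ge0 al; nra.
have h5 : (A + al) * (- p * dot v g) = - (al ^+ 2 * dot v g) by rewrite -pE; ring.
have h6 := xE v.
(* The quadratic terms sum to [al^2 (3/4 |g|^2 - <v, g>)], which equals
   [al^2 (|theta|^2 - |v - theta|^2 / 4)]. *)
have h7 : 0 <= al ^+ 2 * dot (v - theta) (v - theta) by rewrite mulr_ge0 ?sqr_ge0 ?dot_ge0.
move: h1 h4 h5 h7; rewrite gE !dotE ?(dotC theta v).
rewrite ?(dotC z xstar) ?(dotC z v) ?(dotC z theta) ?(dotC xstar v) ?(dotC xstar theta).
move: h2 h3; rewrite ?(dotC x v).
move=> h2 h3 h1 h4 h5 h7.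
lra.
Qed.

(* The gradient at the coupled point is controlled by its value at [y], where
   the potential bounds the function gap, plus smoothness along [z - y]. *)
Lemma grad_coupling_le (A al Rc c d : R) (y z : 'rV[R]_n) : 0 < A -> 0 < al ->
  0 <= Rc -> 0 <= d ->
  norm2 (y - xstar) <= Rc -> potential A y z <= Rc ^+ 2 / 2 ->
  L * al ^+ 2 <= c * (A + al) -> L * al ^+ 2 <= d ^+ 2 * A ->
  al * norm2 (grad f (coupling A al y z)) <= (2 * c + d) * Rc.
Proof.
move=> A0 al0 Rc0 d0 yR V c1 d1.
set x := coupling A al y z.
have A1 : 0 < A + al by rewrite addr_gt0.
have zR : norm2 (z - xstar) <= Rc.
  rewrite -ler_sqr ?nnegrE ?norm2_ge0//; move: V; rewrite /potential.
  have : 0 <= A * (f y - f xstar) by rewrite mulr_ge0 ?subr_ge0// ltW.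
  lra.
have xyE : x - y = (al / (A + al)) *: (z - y).
  by rewrite /x /coupling; apply/rowP => j; rewrite !mxE; field; rewrite gt_eqF.
have zy : norm2 (z - y) <= 2 * Rc.
  rewrite -[z](subrK xstar) -addrA -[xstar - y]opprB.
  apply: le_trans (norm2D _ _) _; rewrite norm2N; lra.
have g1 : al * norm2 (grad f x - grad f y) <= 2 * c * Rc.
  have [_ /(_ x y) fxy] := fL.
  apply: le_trans (ler_wpM2l (ltW al0) fxy) _.
  rewrite xyE norm2Z ger0_norm; last by rewrite divr_ge0// ltW.
  rewrite -(ler_pM2l A1).
  rewrite [leLHS](_ : _ = (L * al ^+ 2) * norm2 (z - y)); last by field; rewrite gt_eqF.
  apply: le_trans (ler_wpM2r (norm2_ge0 _) c1) _.
  rewrite [leRHS](_ : _ = c * (A + al) * (2 * Rc)); last by ring.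
  rewrite ler_wpM2l//; apply: le_trans c1.
  by rewrite mulr_ge0 ?sqr_ge0// ltW.
have g2 : al * norm2 (grad f y) <= d * Rc.
  rewrite -ler_sqr ?nnegrE; first last.
  - by rewrite mulr_ge0.
  - by rewrite mulr_ge0 ?norm2_ge0// ltW.
  have h := sqr_grad_le fL y L0 fmin.
  rewrite exprMn; apply: le_trans (ler_wpM2l (sqr_ge0 al) h) _.
  have fy : A * (f y - f xstar) <= Rc ^+ 2 / 2.
    by apply: le_trans V; rewrite /potential lerDl divr_ge0 ?sqr_ge0.
  rewrite -(ler_pM2l A0).
  rewrite [leLHS](_ : _ = 2 * (L * al ^+ 2) * (A * (f y - f xstar))); last by ring.
  have La : 0 <= L * al ^+ 2 by rewrite mulr_ge0 ?sqr_ge0// ltW.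
  apply: (@le_trans _ _ (2 * (L * al ^+ 2) * (Rc ^+ 2 / 2))).
    by rewrite ler_wpM2l// mulr_ge0.
  rewrite [leLHS](_ : _ = L * al ^+ 2 * Rc ^+ 2); last by field.
  rewrite [leRHS](_ : _ = d ^+ 2 * A * Rc ^+ 2); last by ring.
  by rewrite ler_wpM2r ?sqr_ge0.
rewrite -[grad f x](subrK (grad f y)).
apply: le_trans (ler_wpM2l (ltW al0) (norm2D _ _)) _.
rewrite mulrDr mulrDl; exact: lerD.
Qed.

(** For the first iteration, where [A = 0] and the potential does not control [f y]. *)
Lemma grad_le_dist (x : 'rV[R]_n) : norm2 (grad f x) <= L * norm2 (x - xstar).
Proof.
have g0 : norm2 (grad f xstar) = 0.
  apply/eqP; rewrite -sqrf_eq0 eq_le sqr_ge0 andbT.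
  by have := sqr_grad_le fL xstar L0 fmin; rewrite subrr mulr0.
have [_ /(_ x xstar)] := fL; apply: le_trans.
rewrite -{1}[grad f x](subrK (grad f xstar)).
by apply: le_trans (norm2D _ _) _; rewrite g0 addr0.
Qed.

End OneStep.

(** * Exponential moment of the clipped noise *)

Section Noise.
Context {R : realType}.

Lemma expR_le_quadratic (t : R) : t <= 1 -> expR t <= 1 + t + 2 * t ^+ 2.
Proof.
move=> t1.
have h : 0 < 1 - t / 2 by lra.
(* [e^t = (e^(- t / 2))^-2 <= (1 - t / 2)^-2] *)
have h1 : 1 - t / 2 <= expR (- (t / 2)) by have := expR_ge1Dx (- (t / 2)).
have h2 : expR t * (1 - t / 2) ^+ 2 <= 1.
  apply: (@le_trans _ _ (expR t * expR (- (t / 2)) ^+ 2)).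
    rewrite ler_wpM2l ?expR_ge0// ler_pXn2r ?nnegrE ?expR_ge0//; exact: ltW.
  by rewrite expr2 -!expRD (_ : _ + _ = 0) ?expR0//; field.
have h3 : 1 <= (1 + t + 2 * t ^+ 2) * (1 - t / 2) ^+ 2.
  have : 0 <= t ^+ 2 * ((1 - t) * (5 - 2 * t))
    by apply: mulr_ge0; [exact: sqr_ge0|apply: mulr_ge0; lra].
  lra.
rewrite -(@ler_pM2r _ ((1 - t / 2) ^+ 2)) ?exprn_gt0//; exact: le_trans h3.
Qed.

Context {n : nat}.
Implicit Types u v w g : 'rV[R]_n.

(** The hypothesis is the discriminant condition. Nonnegativity is what allows Tonelli to be applied
    to [mid] below. *)
Lemma quadratic_ge0 u v (b : R) : dot u u <= 4 * b -> 0 <= 1 + dot u v + b * dot v v.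
Proof.
move=> ub; have h := dot_ge u v.
have h1 : norm2 u ^+ 2 * norm2 v ^+ 2 <= 4 * b * norm2 v ^+ 2.
  by rewrite ler_wpM2r ?sqr_ge0// sqr_norm2.
rewrite -(sqr_norm2 v); have := sqr_ge0 (norm2 u * norm2 v / 2 - 1); lra.
Qed.

Variables (R0 Rc l al : R).
Hypotheses (R00 : 0 < R0) (Rc0 : 0 < Rc) (RcE : Rc ^+ 2 = 5 * R0 ^+ 2).
Hypotheses (l2 : 2 <= l) (al0 : 0 < al).

(** The initial gap [2 R0^2] to the threshold is turned into [3/2 l], enough to pay the growth
    [l / 100] and keep [l]. A much larger factor would break the bound 1 on the exponent in
    [exp_noise_le], here at most [3/4 * 35/32 * 15/16]. *)
Definition tilt := 3 / 4 * (l / R0 ^+ 2).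

Let kR0 : l / R0 ^+ 2 * R0 ^+ 2 = l.
Proof. by rewrite divfK// sqrf_eq0 gt_eqF. Qed.

Lemma tilt_sqr_le w : norm2 w <= Rc ->
  dot ((tilt * al) *: w) ((tilt * al) *: w) <= 4 * (12 * (l * (l / R0 ^+ 2)) * al ^+ 2).
Proof.
move=> wR; rewrite !dotE -sqr_norm2.
have h : norm2 w ^+ 2 <= 5 * R0 ^+ 2.
  by rewrite -RcE ler_pXn2r ?nnegrE ?norm2_ge0// ltW.
rewrite mulrA -expr2; apply: le_trans (ler_wpM2l (sqr_ge0 _) h) _.
have XE := kR0; rewrite /tilt; set k := l / R0 ^+ 2 in XE *.
rewrite [leLHS](_ : _ = 45 / 16 * (k * R0 ^+ 2 * k) * al ^+ 2); last by field.
rewrite XE; have : 0 <= l * k * al ^+ 2.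
  have l0 : 0 <= l by have := l2; lra.
  by apply: mulr_ge0; [apply: mulr_ge0 => //; rewrite divr_ge0 ?sqr_ge0|exact: sqr_ge0].
lra.
Qed.

Lemma exp_noise_le w v g :
  let lam := Rc / (8 * l) / al in
  norm2 v <= lam / 2 -> norm2 w <= Rc ->
  let theta := clip g lam - v in
  expR (tilt * (al * dot theta w + al ^+ 2 * dot theta theta)) <=
  1 + dot ((tilt * al) *: w) (g - v)
    + 12 * (l * (l / R0 ^+ 2)) * al ^+ 2 * dot (g - v) (g - v).
Proof.
cbv zeta; set lam := Rc / (8 * l) / al => vl wR.
set theta := clip g lam - v; set eta := g - v.
have l0 : 0 < l by have := l2; lra.
have lam0 : 0 < lam by rewrite !divr_gt0// mulr_gt0.
have alam : 8 * l * (al * lam) = Rc by rewrite /lam; field; rewrite !gt_eqF.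
(* By [alam], the bias costs [al |eta|^2 Rc / (2 lam) = 4 l al^2 |eta|^2]. *)
have h1 : al * dot theta w <= al * dot eta w + 4 * l * (al ^+ 2 * dot eta eta).
  have -> : theta = eta + (clip g lam - g) by rewrite /theta /eta [RHS]addrC [RHS]addrA subrK.
  rewrite dotDl mulrDr lerD2l.
  have h : dot (clip g lam - g) w <= dot eta eta / (2 * lam) * Rc.
    apply: le_trans (dot_le _ _) _; apply: ler_pM => //; rewrite ?norm2_ge0//.
    by rewrite -sqr_norm2; exact: clip_bias.
  apply: le_trans (ler_wpM2l (ltW al0) h) _.
  by rewrite -alam le_eqVlt; apply/orP; left; apply/eqP; field; rewrite gt_eqF.
set q := al * norm2 theta.
have q0 : 0 <= q by rewrite mulr_ge0 ?norm2_ge0// ltW.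
have q2E : al ^+ 2 * dot theta theta = q ^+ 2 by rewrite -sqr_norm2 -exprMn.
have h2 : q ^+ 2 <= al ^+ 2 * dot eta eta.
  by rewrite -q2E ler_wpM2l ?sqr_ge0//; exact: clip_contract.
have h3 : al * dot theta w <= q * Rc.
  rewrite /q -mulrA ler_wpM2l ?(ltW al0)//; apply: le_trans (dot_le _ _) _.
  by rewrite ler_wpM2l ?norm2_ge0.
have h3' : - (q * Rc) <= al * dot theta w.
  rewrite /q -mulrA -mulrN ler_wpM2l ?(ltW al0)//; apply: le_trans (dot_ge _ _).
  by rewrite lerN2 ler_wpM2l ?norm2_ge0.
(* Here the clipping level bounds the exponent: [q] is at most [3/2 al lam], that is
   [3 Rc / (16 l)]. *)
have h4 : 16 * l * q <= 3 * Rc.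
  have : q <= al * (3 / 2 * lam) by rewrite ler_wpM2l ?(ltW al0)//; exact: clip_dist.
  move/(ler_wpM2l (ltW l0)); have := alam; nra.
have h5 : 32 * q <= 3 * Rc.
  by apply: le_trans h4; rewrite ler_wpM2r//; have := l2; lra.
rewrite q2E dotZl (dotC w); set X := al * dot theta w in h1 h3 h3' *.
have XE := kR0; rewrite /tilt; set k := l / R0 ^+ 2 in XE *.
have k0 : 0 <= k by rewrite divr_ge0 ?sqr_ge0// (ltW l0).
have h6 : q ^+ 2 <= 3 / 32 * (q * Rc) by have := mulr_ge0 q0 (ltW Rc0); nra.
have h7 : k * (q * Rc) <= 15 / 16.
  have h : 16 * l * (q * Rc) <= 15 * R0 ^+ 2.
    by rewrite mulrA; have := ler_wpM2r (ltW Rc0) h4; have := RcE; lra.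
  have := ler_wpM2l k0 h; rewrite [X in _ <= X](_ : _ = 15 * l); last by rewrite -XE; ring.
  rewrite [X in X <= _](_ : _ = l * (16 * (k * (q * Rc)))); last by ring.
  by rewrite [X in _ <= X]mulrC ler_pM2l//; lra.
apply: le_trans (expR_le_quadratic _) _.
  have : k * (X + q ^+ 2) <= k * (35 / 32 * (q * Rc)) by rewrite ler_wpM2l//; lra.
  lra.
have h8 : (X + q ^+ 2) ^+ 2 <= 6 * R0 ^+ 2 * q ^+ 2.
  have : (X + q ^+ 2) ^+ 2 <= (35 / 32 * (q * Rc)) ^+ 2.
    have q2 : 0 <= q ^+ 2 by exact: sqr_ge0.
    have qR := mulr_ge0 q0 (ltW Rc0).
    rewrite -subr_ge0 subr_sqr mulr_ge0//; lra.
  rewrite [X in _ <= X -> _](_ : _ = (35 / 32) ^+ 2 * Rc ^+ 2 * q ^+ 2); last by ring.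
  rewrite RcE; have : 0 <= R0 ^+ 2 * q ^+ 2 by rewrite mulr_ge0 ?sqr_ge0.
  lra.
have h9 : 2 * (3 / 4 * k * (X + q ^+ 2)) ^+ 2 <= 27 / 4 * (l * k) * (al ^+ 2 * dot eta eta).
  rewrite [leLHS](_ : _ = 9 / 8 * (k ^+ 2 * (X + q ^+ 2) ^+ 2)); last by field.
  have := ler_wpM2l (sqr_ge0 k) h8.
  rewrite [X in _ <= X -> _](_ : _ = 6 * (k * R0 ^+ 2) * k * q ^+ 2); last by ring.
  rewrite XE; have := ler_wpM2l (mulr_ge0 (ltW l0) k0) h2; lra.
have h10 : 3 / 4 * k * (X + q ^+ 2) <=
    3 / 4 * k * (al * dot eta w) + 3 / 4 * k * (9 / 2 * l * (al ^+ 2 * dot eta eta)).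
  rewrite -mulrDr; apply: ler_wpM2l; first by apply: mulr_ge0 => //; lra.
  have : 0 <= (l - 2) * (al ^+ 2 * dot eta eta).
    apply: mulr_ge0; first by rewrite subr_ge0.
    by rewrite mulr_ge0 ?sqr_ge0 ?dot_ge0.
  nra.
(* The coefficients of [l k al^2 |eta|^2] are 27/4 from [h9] and 27/8 from [h10], together below 12.
   In [h10], [9/2 l] covers [4 l] from the bias and 1 from [|theta|^2]. *)
have : 0 <= l * k * (al ^+ 2 * dot eta eta).
  by apply: mulr_ge0; [exact: mulr_ge0 (ltW l0) k0|rewrite mulr_ge0 ?sqr_ge0 ?dot_ge0].
lra.
Qed.

End Noise.

(** * Fresh samples *)

Section Fresh.
Local Open Scope ereal_scope.

Definition image_measure d d' (T : measurableType d) (T' : measurableType d')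
    (R : realType) (m : {measure set T -> \bar R}) (f : T -> T')
    (mf : measurable_fun setT f) : {measure set T' -> \bar R} :=
  measure_function_pushforward__canonical__measure_function_Measure m mf.

Lemma rectangle_measure_unique d1 d2 (T1 : measurableType d1)
    (T2 : measurableType d2) (R : realType)
    (m1 m2 : {measure set (T1 * T2) -> \bar R}) :
  m1 setT < +oo ->
  (forall A B, measurable A -> measurable B -> m1 (A `*` B) = m2 (A `*` B)) ->
  forall E, measurable E -> m1 E = m2 E.
Proof.
move=> m1oo m12 E mE.
pose C : set (set (T1 * T2)) :=
  [set C | exists A, measurable A /\ exists B, measurable B /\ C = A `*` B].
apply: (measure_unique C (fun=> setT)) => //.
- rewrite measurable_prod_measurableType //; congr (<<s _ >>).
  rewrite predeqE; split => [[A mA [B mB <-]]|[A [mA [B [mB ->]]]]].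
    by exists A; split => //; exists B.
  by exists A => //; exists B.
- move=> _ _ [X1 [mX1 [X2 [mX2 ->]]]] [Y1 [mY1 [Y2 [mY2 ->]]]].
  rewrite -setXI; exists (X1 `&` Y1); split; first exact: measurableI.
  by exists (X2 `&` Y2); split => //; exact: measurableI.
- by move=> _; exists setT; split => //; exists setT; split => //; rewrite setXTT.
- by rewrite bigcup_const.
- by move=> _ [A [mA [B [mB ->]]]]; exact: m12.
Qed.

Context (R : realType) (dO dX dS : measure_display) (Omega : measurableType dO)
  (Xi : measurableType dX) (P : probability Omega R) (D : probability Xi R)
  (I : eqType) (X : I -> Omega -> Xi).

Definition fresh_event (K : seq I) (B : I -> set Xi) : set Omega :=
  [set w | forall i, i \in K -> B i (X i w)].

(** Independence of [s] from the samples in [J], combined with their product law, tested on finite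
    rectangles. This is the invariant of the run: each draw removes one index from [J]. *)
Definition fresh d (S : measurableType d) (s : Omega -> S) (J : set I) : Prop :=
  measurable_fun setT s /\
  forall K : seq I, uniq K -> (forall i, i \in K -> J i) ->
  forall B : I -> set Xi, (forall i, measurable (B i)) ->
  forall A, measurable A ->
  P (s @^-1` A `&` fresh_event K B) = P (s @^-1` A) * \prod_(i <- K) D (B i).

Lemma measurable_fresh_event (K : seq I) (B : I -> set Xi) :
  (forall i, i \in K -> measurable_fun setT (X i)) ->
  (forall i, measurable (B i)) -> measurable (fresh_event K B).
Proof.
move=> + mB; elim: K => [_|i K IH mX].
  rewrite [X in measurable X](_ : _ = setT)//.
  by apply/seteqP; split=> // w _ i; rewrite in_nil.
rewrite [X in measurable X](_ : _ = (X i @^-1` B i) `&` fresh_event K B).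
  apply: measurableI.
    by rewrite -[X in measurable X]setTI; apply: mX => //; rewrite mem_head.
  by apply: IH => j jK; apply: mX; rewrite in_cons jK orbT.
apply/seteqP; split=> [w h|w [h1 h2] j].
  by split=> [|j jK]; apply: h; rewrite in_cons ?eqxx ?jK ?orbT.
by rewrite in_cons => /orP[/eqP ->//|/h2].
Qed.

Lemma fresh_cst d (S : measurableType d) (s0 : S) (J : set I) :
  iid_samples P D J X -> fresh (fun=> s0) J.
Proof.
move=> [mX XD iX]; split=> [|K uK KJ B mB A mA]; first exact: measurable_cst.
have PK : P (fresh_event K B) = \prod_(i <- K) D (B i).
  rewrite /fresh_event iX//; apply: eq_big_seq => i iK.
  by rewrite XD//; exact: KJ.
rewrite preimage_cst; case: ifPn => _; last by rewrite set0I measure0 mul0e.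
by rewrite setTI PK probability_setT mul1e.
Qed.

Variable J : set I.
Hypothesis mX : forall i, J i -> measurable_fun setT (X i).

Lemma fresh_comp d d' (S : measurableType d) (S' : measurableType d')
    (s : Omega -> S) (h : S -> S') :
  measurable_fun setT h -> fresh s J -> fresh (h \o s) J.
Proof.
move=> mh [ms fs]; split; first exact: measurableT_comp.
move=> K uK KJ B mB A mA; rewrite comp_preimage; apply: fs => //.
by rewrite -[X in measurable X]setTI; exact: mh.
Qed.

Lemma fresh_sub d (S : measurableType d) (s : Omega -> S) (J' : set I) :
  J' `<=` J -> fresh s J -> fresh s J'.
Proof.
move=> JJ [ms fs]; split=> // K uK KJ; apply: fs => // i iK.
by apply: JJ; exact: KJ.
Qed.

Context (d : measure_display) (S : measurableType d) (s : Omega -> S) (p : I).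
Hypothesis fs : fresh s J.
Hypothesis Jp : J p.

Lemma measurable_fresh_pair : measurable_fun setT (fun w => (s w, X p w)).
Proof. by apply/measurable_fun_pair; [case: fs|exact: mX]. Qed.

(** Events of the pair are not rectangles in general. The factorization is checked on rectangles,
    where the condition on [X p] joins the family [B] as one more factor, and extended by uniqueness
    of finite measures. *)
Lemma fresh_pair : fresh (fun w => (s w, X p w)) (J `\ p).
Proof.
split=> [|K uK KJ B mB E mE]; first exact: measurable_fresh_pair.
have mK : measurable (fresh_event K B).
  by apply: measurable_fresh_event => // i /KJ[/mX].
have prod_ge0 : 0 <= \prod_(i <- K) D (B i) by apply: prode_ge0 => i _.
have prod_fin : \prod_(i <- K) D (B i) \is a fin_num.
  by apply: prode_fin_num => i _; exact: fin_num_measure.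
have c0 : (0 <= fine (\prod_(i <- K) D (B i)))%R by exact: fine_ge0.
pose m1 := image_measure (mrestr P mK) measurable_fresh_pair.
pose m2 := mscale (NngNum c0) (image_measure P measurable_fresh_pair).
suff : m1 E = m2 E.
  rewrite /m1 /m2 /= /mscale/= /pushforward /mrestr /= => ->.
  by rewrite fineK// muleC.
apply: rectangle_measure_unique => //.
  by rewrite /m1 /= /pushforward /mrestr preimage_setT setTI ltey_eq fin_num_measure.
move=> A C mA mC.
rewrite /m1 /m2 /= /mscale/= /pushforward /mrestr /= fineK//.
pose B' i := if i == p then C else B i.
have mB' i : measurable (B' i) by rewrite /B'; case: ifP.
have pK : p \notin K by apply/negP => /KJ[_]; exact.
have evK : fresh_event K B' = fresh_event K B.
  apply/seteqP; split=> w h i iK; move: (h i iK); rewrite /B'; case: eqP => // ip;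
  by move: pK; rewrite -ip iK.
have evp K' : (fun w => (s w, X p w)) @^-1` (A `*` C) `&` fresh_event K' B' =
    s @^-1` A `&` fresh_event (p :: K') B'.
  apply/seteqP; split=> [w [[/= h1 h2] h3]|w [h1 h2]].
    split=> // i; rewrite in_cons => /orP[/eqP ->|/h3//].
    by rewrite /B' eqxx.
  split; last by move=> i iK; apply: h2; rewrite in_cons iK orbT.
  split=> //=; have := h2 p; rewrite mem_head /B' eqxx; exact.
have prB : \prod_(i <- K) D (B' i) = \prod_(i <- K) D (B i).
  apply: eq_big_seq => i iK; rewrite /B'; case: eqP => // ip.
  by move: pK; rewrite -ip iK.
(* With no further sample, the same factorization computes the law of the pair itself. *)
have ev0 (A' : set Omega) : A' = A' `&` fresh_event [::] B'.
  by apply/seteqP; split=> [w h|w []//]; split.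
have [_ fE] := fs.
rewrite -evK evp fE//=; first last.
- by move=> i; rewrite in_cons => /orP[/eqP ->//|/KJ[]].
- by rewrite pK.
rewrite [X in _ = _ * P X]ev0 evp fE//=; last first.
  by move=> i; rewrite inE => /eqP ->.
by rewrite !big_cons big_nil mule1 prB [RHS]muleC muleA.
Qed.

(** Stands in for conditional expectation: the law of the pair is a product measure, and Tonelli
    integrates the sample first. *)
Lemma fresh_step (h : S * Xi -> \bar R) (h' : S -> \bar R) :
  @measurable_fun _ _ (S * Xi)%type (\bar R) setT h -> (forall a, 0 <= h a) ->
  measurable_fun setT h' ->
  (forall a, \int[D]_x h (a, x) <= h' a) ->
  \int[P]_w h (s w, X p w) <= \int[P]_w h' (s w).
Proof.
move=> mh h0 mh' hh'.
have [ms fE] := fs.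
pose sm : {mfun Omega >-> S} := HB.pack s (@isMeasurableFun.Build _ _ _ _ s ms).
have law E : measurable E ->
    (distribution P sm \x D) E = image_measure P measurable_fresh_pair E.
  move=> mE; apply: product_measure_unique => // A B mA mB.
  rewrite /= /distribution /pushforward.
  have := fE [:: p] isT _ (fun=> B) (fun=> mB) A mA.
  rewrite big_seq1 => <- //; last by move=> i; rewrite inE => /eqP ->.
  congr (P _); apply/seteqP; split=> w [h1 h2]; split=> //.
    by move=> i; rewrite inE => /eqP ->.
  by apply: h2; rewrite mem_head.
have -> : \int[P]_w h (s w, X p w) =
    \int[pushforward P (fun w => (s w, X p w))]_z h z.
  rewrite (ge0_integral_pushforward measurable_fresh_pair)//.
have -> : \int[pushforward P (fun w => (s w, X p w))]_z h z =
    \int[distribution P sm \x D]_z h z.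
  by apply/esym; apply: (eq_measure_integral (image_measure P measurable_fresh_pair)) => E mE _;
    exact: law.
rewrite fubini_tonelli1// /distribution (ge0_integral_pushforward ms)//; last 2 first.
- exact: measurable_fun_fubini_tonelli_F.
- by move=> a _; exact: integral_ge0.
rewrite preimage_setT; apply: ge0_le_integral => //.
- by move=> w _; exact: integral_ge0.
- by apply: measurableT_comp => //; exact: measurable_fun_fubini_tonelli_F.
- exact: (measurableT_comp mh' ms).
- by move=> w _; exact: hh'.
Qed.

End Fresh.

(** * Measurability of vector-valued maps *)

Section Coordinatewise.
Context {R : realType} {n : nat}.

(** Measurability is taken coordinatewise; [vtuple] and [vrow] move between vectors, which carry
    norm and gradient, and tuples, which carry the sigma-algebra. *)
Definition vec_measurable d (T : measurableType d) (v : T -> 'rV[R]_n) : Prop :=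
  forall j, measurable_fun setT (fun t => v t 0 j).

Definition vtuple (v : 'rV[R]_n) : n.-tuple R := [tuple v 0 i | i < n].

Definition vrow (t : n.-tuple R) : 'rV[R]_n := \row_i tnth t i.

Lemma vtupleK v : vrow (vtuple v) = v.
Proof. by apply/rowP => j; rewrite mxE tnth_mktuple. Qed.

Context {d : measure_display} {T : measurableType d}.
Implicit Types v w : T -> 'rV[R]_n.

Lemma measurable_vtuple v : vec_measurable v -> measurable_fun setT (vtuple \o v).
Proof.
move=> mv; apply/measurable_fun_tnthP => j.
by rewrite (_ : _ \o _ = (fun t => v t 0 j))//; apply/funext => t /=; rewrite tnth_mktuple.
Qed.

Lemma vec_measurable_row (h : T -> n.-tuple R) :
  measurable_fun setT h -> vec_measurable (vrow \o h).
Proof.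
move=> /measurable_fun_tnthP mh j.
by rewrite (_ : (fun _ => _) = (@tnth _ _)^~ j \o h)//; apply/funext => t /=; rewrite mxE.
Qed.

Lemma vec_measurable_cst (c : 'rV[R]_n) : vec_measurable (fun _ : T => c).
Proof. by move=> j; exact: measurable_cst. Qed.

Lemma vec_measurableD v w :
  vec_measurable v -> vec_measurable w -> vec_measurable (fun t => v t + w t).
Proof.
move=> mv mw j; rewrite (_ : (fun _ => _) = (fun t => v t 0 j + w t 0 j)).
  exact: measurable_funD.
by apply/funext => t; rewrite mxE.
Qed.

Lemma vec_measurableZ (c : T -> R) v : measurable_fun setT c ->
  vec_measurable v -> vec_measurable (fun t => c t *: v t).
Proof.
move=> mc mv j; rewrite (_ : (fun _ => _) = (fun t => c t * v t 0 j)).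
  exact: measurable_funM.
by apply/funext => t; rewrite mxE.
Qed.

Lemma vec_measurableZc (c : R) v :
  vec_measurable v -> vec_measurable (fun t => c *: v t).
Proof. exact: vec_measurableZ (measurable_cst _). Qed.

Lemma vec_measurableB v w :
  vec_measurable v -> vec_measurable w -> vec_measurable (fun t => v t - w t).
Proof.
move=> mv mw; apply: vec_measurableD => // j.
rewrite (_ : (fun _ => _) = (fun t => -1 * w t 0 j)).
  by apply: measurable_funM => //; exact: measurable_cst.
by apply/funext => t; rewrite mxE mulN1r.
Qed.

Lemma measurable_dot v w : vec_measurable v -> vec_measurable w ->
  measurable_fun setT (fun t => dot (v t) (w t)).
Proof. by move=> mv mw; apply: measurable_sum => j; exact: measurable_funM. Qed.

Lemma measurable_norm2 v :
  vec_measurable v -> measurable_fun setT (fun t => norm2 (v t)).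
Proof.
move=> mv; rewrite (_ : (fun _ => _) = Num.sqrt \o (fun t => dot (v t) (v t))).
  apply: measurableT_comp; last exact: measurable_dot.
  exact: (continuous_measurable_fun (@sqrt_continuous R)).
by apply/funext => t /=; rewrite -sqr_norm2 sqrtr_sqr ger0_norm ?norm2_ge0.
Qed.

Lemma vec_measurable_clip (lam : R) v :
  vec_measurable v -> vec_measurable (fun t => clip (v t) lam).
Proof.
move=> mv; apply: vec_measurableZ => //.
apply: measurable_minr; first exact: measurable_cst.
apply: measurable_funM; first exact: measurable_cst.
(* The inverse is the power with exponent -1; both are 0 at 0, so no case split is needed. *)
rewrite (_ : (fun _ => _) = (@powR R ^~ (-1)) \o (fun t => norm2 (v t))).
  apply: measurableT_comp; [exact: measurable_powR|exact: measurable_norm2].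
by apply/funext => t /=; rewrite powR_inv1 ?norm2_ge0.
Qed.

Let box (v : T -> 'rV[R]_n) (p : 'rV[rat]_n * nat) : set T :=
  [set t | forall j, `|v t 0 j - ratr (p.1 0 j)| < p.2.+1%:R^-1].

(** The open set where [phi] exceeds [a] is a countable union of rational boxes, and the preimage of
    a box is a finite intersection of coordinate conditions. *)
Lemma measurable_continuous_vec (phi : 'rV[R]_n -> R) v :
  continuous phi -> vec_measurable v -> measurable_fun setT (phi \o v).
Proof.
move=> cphi mv.
apply: (measurability _ (RGenOInfty.measurableE R)).
move=> _ [_ [a ->] <-]; rewrite setTI.
pose good (p : 'rV[rat]_n * nat) : Prop :=
  forall u : 'rV[R]_n, (forall j, `|u 0 j - ratr (p.1 0 j)| < p.2.+1%:R^-1) -> a < phi u.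
rewrite (_ : _ @^-1` _ = \bigcup_p [set t | good p /\ box v p t]).
  apply: countable_bigcupT_measurable; first exact: countableP.
  move=> p; have [gp|gp] := pselect (good p); last first.
    by rewrite (_ : [set _ | _] = set0)//; apply/seteqP; split=> t // [].
  rewrite (_ : [set _ | _] = ~` \bigcup_(j in [set: 'I_n])
      [set t | (`|v t 0 j - ratr (p.1 0 j)| < p.2.+1%:R^-1) = false]); last first.
    apply/seteqP; split=> [t [_ h] [j _ /=]|t h]; first by rewrite h.
    split=> // j; have [//|h'] := boolP (`|v t 0 j - ratr (p.1 0 j)| < p.2.+1%:R^-1).
    by exfalso; apply: h; exists j => //=; exact/negbTE.
  apply: measurableC; apply: fin_bigcup_measurable; first exact: finite_finset.
  move=> j _; rewrite -[X in measurable X]setTI.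
  apply: (@measurable_fun_ltr _ _ _ _ (fun t => `|v t 0 j - ratr (p.1 0 j)|)
    (cst p.2.+1%:R^-1) _ _ measurableT [set false]) => //.
  apply: measurableT_comp; first exact: normr_measurable.
  by apply: measurable_funB => //; exact: measurable_cst.
apply/seteqP; split=> [t /= | t [p _ [gp /gp]]]; last by rewrite /= in_itv/= andbT.
rewrite in_itv/= andbT => at_.
have : nbhs (v t) [set u | a < phi u] by exact: (cvgr_gt _ (cphi (v t)) _ at_).
move=> /nbhs_ballP[e /= e0 he].
(* The box has a rational centre within [k.+1%:R^-1] of [v t] and the same radius, so its points are
   within twice that of [v t]. *)
have [k hk] : exists k : nat, 2 * k.+1%:R^-1 < e.
  have := near_infty_natSinv_lt (PosNum (divr_gt0 e0 (ltr0n _ 2))).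
  move=> [k _ /(_ k (leqnn _))] /= h; exists k.
  by move: h; rewrite ltr_pdivlMr// mulrC.
have k0 : 0 < k.+1%:R^-1 :> R by rewrite invr_gt0.
have q_ j : {q : rat | `|v t 0 j - ratr q| < k.+1%:R^-1}.
  apply: cid; move: k0; set c := k.+1%:R^-1; clearbody c => k0.
  have : v t 0 j - c < v t 0 j + c by lra.
  move=> /rat_in_itvoo[q]; rewrite in_itv/= => /andP[h1 h2].
  by exists q; rewrite ltr_norml; apply/andP; split; lra.
exists (\row_j sval (q_ j), k) => //; split; last first.
  by move=> j /=; rewrite mxE; exact: (svalP (q_ j)).
move=> u /= hu; apply: (he u); split=> // i j; rewrite (ord1 i) /ball/=.
have := hu j; rewrite mxE => h1; have h2 := svalP (q_ j).
rewrite -(subrKA (ratr (sval (q_ j)))) (le_lt_trans (ler_normD _ _))//.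
rewrite [X in _ + X]distrC; apply: lt_trans hk; rewrite mulr_natl mulr2n; exact: ltrD.
Qed.

End Coordinatewise.

(** * Measurability of a smooth function and its gradient at a random point *)

Section Gradient.
Context {R : realType} {n : nat}.

Lemma continuous_norm2B (x : 'rV[R]_n) : continuous (fun y : 'rV[R]_n => norm2 (x - y)).
Proof.
move=> y; apply: (@continuous_comp _ _ _
  (fun y : 'rV[R]_n => \sum_(j < n) (x - y) 0 j ^+ 2) Num.sqrt).
  apply: cvg_big => [||j _]; first exact: add_continuous.
    exact: nbhs_filter.
  apply: (@continuous_comp _ _ _ (fun y : 'rV[R]_n => (x - y) 0 j) (fun r : R => r ^+ 2)).
    rewrite (_ : (fun _ => _) = (fun y : 'rV[R]_n => x 0 j - y 0 j)); last first.
      by apply/funext => u; rewrite !mxE.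
    by apply: continuousB; [exact: cst_continuous|exact: coord_continuous].
  exact: exprn_continuous.
exact: sqrt_continuous.
Qed.

Lemma abs_coord_le (x : 'rV[R]_n) j : `|x 0 j| <= norm2 x.
Proof.
rewrite -sqrtr_sqr /norm2; apply: ler_wsqrtr.
by rewrite (bigD1 j)//= lerDl; apply: sumr_ge0 => i _; exact: sqr_ge0.
Qed.

(** The Lipschitz bound is Euclidean and the topology comes from the sup norm; continuity of
    [norm2 (x - y)] in [y] bridges the two. *)
Lemma continuous_grad (f : 'rV[R]_n -> R) (L : R) j :
  smooth f L -> continuous (fun x => grad f x 0 j).
Proof.
move=> [_ fL] x.
have lim0 : (L * norm2 (x - y)) @[y --> x] --> (0 : R).
  have n0 : norm2 (x - x) = 0 by rewrite subrr -(scale0r x) norm2Z normr0 mul0r.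
  have : continuous_at x (fun y => L * norm2 (x - y)).
    apply: (@continuous_comp _ _ _ (fun y : 'rV[R]_n => norm2 (x - y)) ( *%R L)).
      exact: continuous_norm2B.
    exact: mulrl_continuous.
  by rewrite /continuous_at n0 mulr0.
have FF := @nbhs_filter _ x.
apply/(@cvgrPdist_le _ _ _ _ FF) => e e0.
move/(@cvgrPdist_le _ _ _ _ FF) : lim0 => /(_ e e0); apply: filterS => y.
rewrite sub0r normrN => h; apply: le_trans (le_trans (ler_norm _) h).
by apply: le_trans (fL x y); apply: le_trans (abs_coord_le _ j); rewrite !mxE.
Qed.

Lemma vec_measurable_grad (f : 'rV[R]_n -> R) (L : R) d (T : measurableType d)
    (v : T -> 'rV[R]_n) :
  smooth f L -> vec_measurable v -> vec_measurable (fun t => grad f (v t)).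
Proof.
move=> fL mv j; exact: (measurable_continuous_vec (continuous_grad (j := j) fL) mv).
Qed.

Lemma measurable_smooth (f : 'rV[R]_n -> R) (L : R) d (T : measurableType d)
    (v : T -> 'rV[R]_n) :
  smooth f L -> vec_measurable v -> measurable_fun setT (fun t => f (v t)).
Proof.
move=> [df _] mv; apply: (measurable_continuous_vec _ mv) => x.
exact: differentiable_continuous.
Qed.

End Gradient.

(** * Expectation of a quadratic in one stochastic gradient *)

Section Expectation.
Context {R : realType} {n : nat} {d : measure_display} {T : measurableType d}.
Variable D : probability T R.
Local Open Scope ereal_scope.

(** The integral is the difference of those of the positive and negative parts; as [+oo - +oo] is
    [-oo], a finite value forces both to be finite. *)
Lemma integrable_of_fin_num (h : T -> R) : measurable_fun setT h ->
  \int[D]_x (h x)%:E \is a fin_num -> D.-integrable setT (EFin \o h).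
Proof.
move=> mh hfin; have mEh : measurable_fun setT (EFin \o h) by exact/measurable_EFinP.
apply/integrableP; split=> //.
have hp : 0 <= \int[D]_x (EFin \o h)^\+ x by exact: integral_ge0.
have hn : 0 <= \int[D]_x (EFin \o h)^\- x by exact: integral_ge0.
rewrite (_ : (fun x => _) = (EFin \o h)^\+ \+ (EFin \o h)^\-); last first.
  by rewrite -fune_abse.
rewrite ge0_integralD//; last 2 first.
- exact: measurable_funepos.
- exact: measurable_funeneg.
move: hfin; rewrite [X in X \is a fin_num]integralE.
by move: hp hn; case: (integral _ _ _) => [r| |]//;
  case: (integral _ _ _) => [s| |]//= _ _ _; rewrite ltry.
Qed.

Lemma expect_quadratic_le (g : T -> 'rV[R]_n) (mu w : 'rV[R]_n) (sigma c b : R) :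
  vec_measurable g -> (forall j, 'E_D[fun x => (g x 0 j)%R] = (mu 0 j)%:E) ->
  'E_D[fun x => (norm2 (g x - mu) ^+ 2)%R] <= (sigma ^+ 2)%:E -> (0 <= b)%R ->
  \int[D]_x (c + dot w (g x - mu) + b * dot (g x - mu) (g x - mu))%:E
    <= (c + b * sigma ^+ 2)%:E.
Proof.
move=> mg gmu gs b0.
have mq : measurable_fun setT (fun x => dot (g x - mu) (g x - mu)).
  by apply: measurable_dot; apply: vec_measurableB => //; exact: vec_measurable_cst.
have gI j : D.-integrable setT (fun x => (g x 0 j)%:E).
  apply: integrable_of_fin_num; first exact: mg.
  by have := gmu j; rewrite unlock => ->.
have qs : \int[D]_x (dot (g x - mu) (g x - mu))%:E <= (sigma ^+ 2)%:E.
  apply: le_trans gs; rewrite unlock le_eqVlt; apply/orP; left; apply/eqP.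
  by apply: eq_integral => x _; rewrite sqr_norm2.
have q0 x : 0 <= (dot (g x - mu) (g x - mu))%:E by rewrite lee_fin dot_ge0.
have qI : D.-integrable setT (fun x => (dot (g x - mu) (g x - mu))%:E).
  apply: integrable_of_fin_num => //; rewrite ge0_fin_numE ?integral_ge0//.
  by apply: le_lt_trans qs _; rewrite ltry.
have cI r : D.-integrable setT (fun=> r%:E) by exact: finite_measure_integrable_cst.
have zI (h : T -> \bar R) r : D.-integrable setT h -> D.-integrable setT (fun x => r%:E * h x).
  exact: integrableZl.
rewrite (_ : (fun x => _) = (fun x =>
    ((c - dot w mu)%:E + \sum_(j < n) ((w 0 j)%:E * (g x 0 j)%:E))
    + b%:E * (dot (g x - mu) (g x - mu))%:E)); last first.
  apply/funext => x; rewrite sumEFin -EFinM -!EFinD; congr EFin; congr (_ + _)%R.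
  rewrite dotDr dotNr /dot; ring.
have sI : D.-integrable setT (fun x => \sum_(j < n) ((w 0 j)%:E * (g x 0 j)%:E)).
  by apply: integrable_sum => // j _; exact: zI.
rewrite integralD//; [|exact: integrableD|exact: zI].
rewrite integralD// integralZl// integral_sum//; last by move=> j; exact: zI.
rewrite integral_cst// [X in _ * X](_ : _ = 1) ?mule1; last exact: probability_setT.
rewrite (eq_bigr (fun j => (w 0 j * mu 0 j)%:E)); last first.
  move=> j _; rewrite integralZl//; have := gmu j; rewrite unlock => ->.
  by rewrite EFinM.
rewrite sumEFin -EFinD subrK EFinD EFinM leeD2l//.
by rewrite lee_wpmul2l.
Qed.

End Expectation.

(** * The algorithm as a chain driven by one sample at a time *)

Section Chain.
Context {R : realType} {n : nat}.
Context {dO dX : measure_display} {Omega : measurableType dO} {Xi : measurableType dX}.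
Variables (P : probability Omega R) (D : probability Xi R).
Variables (G : 'rV[R]_n -> Xi -> 'rV[R]_n) (L a B : R) (m : nat -> nat) (N : nat).
Variables (x0 : 'rV[R]_n) (xi : nat -> nat -> Omega -> Xi).

Definition state : Type := (n.-tuple R * n.-tuple R * n.-tuple R)%type.
HB.instance Definition _ := Measurable.on state.

(* The third component is the sum of the stochastic gradients drawn so far in
   the current iteration. *)
Definition sy (s : state) : 'rV[R]_n := vrow s.1.1.
Definition sz (s : state) : 'rV[R]_n := vrow s.1.2.
Definition sg (s : state) : 'rV[R]_n := vrow s.2.

Definition query k (s : state) : 'rV[R]_n :=
  coupling (Aseq a L k) (alpha a L k.+1) (sy s) (sz s).

Definition sample_step k (s : state) (x : Xi) : state :=
  (s.1, vtuple (sg s + G (query k s) x)).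

Definition close_step k (s : state) : state :=
  let al := alpha a L k.+1 in
  let z' := sz s - al *: clip ((m k)%:R^-1 *: sg s) (B / al) in
  (vtuple (coupling (Aseq a L k) al (sy s) z'), vtuple z', vtuple 0).

Definition iterate k (w : Omega) : 'rV[R]_n * 'rV[R]_n :=
  clipped_SSTM G L a B m x0 (fun k i => xi k i w) k.

(** Read off the algorithm itself, after [i] samples of iteration [k]. The index pairs [(k, m k)]
    and [(k.+1, 0)] are joined by [close_step], which draws no sample. *)
Definition trajectory k i (w : Omega) : state :=
  let yz := iterate k w in
  (vtuple yz.1, vtuple yz.2,
   vtuple (\sum_(j < i)
     G (coupling (Aseq a L k) (alpha a L k.+1) yz.1 yz.2) (xi k j w))).

Lemma trajectory_sample k i w :
  trajectory k i.+1 w = sample_step k (trajectory k i w) (xi k i w).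
Proof.
by rewrite /trajectory /sample_step /query /sy /sz /sg /= !vtupleK big_ord_recr.
Qed.

Lemma trajectory_close k w :
  trajectory k.+1 0 w = close_step k (trajectory k (m k) w).
Proof.
rewrite /trajectory /close_step /sy /sz /sg /= !vtupleK big_ord0 /iterate /=.
by case: clipped_SSTM => y z /=.
Qed.

Lemma vec_measurable_sy : vec_measurable sy.
Proof.
apply: (@vec_measurable_row _ _ _ _ (fun s : state => s.1.1)).
exact: (measurableT_comp measurable_fst measurable_fst).
Qed.

Lemma vec_measurable_sz : vec_measurable sz.
Proof.
apply: (@vec_measurable_row _ _ _ _ (fun s : state => s.1.2)).
exact: (measurableT_comp measurable_snd measurable_fst).
Qed.

Lemma vec_measurable_sg : vec_measurable sg.
Proof. apply: (@vec_measurable_row _ _ _ _ (fun s : state => s.2)); exact: measurable_snd. Qed.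

Lemma vec_measurable_comp d d' (T : measurableType d) (U : measurableType d')
    (h : T -> U) (v : U -> 'rV[R]_n) :
  measurable_fun setT h -> vec_measurable v -> vec_measurable (v \o h).
Proof. by move=> mh mv j; exact: (measurableT_comp (mv j) mh). Qed.

Lemma vec_measurable_coupling d (T : measurableType d) (A al : R) (y z : T -> 'rV[R]_n) :
  vec_measurable y -> vec_measurable z ->
  vec_measurable (fun t => coupling A al (y t) (z t)).
Proof.
by move=> my mz; apply: vec_measurableZc; apply: vec_measurableD; exact: vec_measurableZc.
Qed.

Lemma vec_measurable_query k : vec_measurable (query k).
Proof.
apply: vec_measurable_coupling; [exact: vec_measurable_sy|exact: vec_measurable_sz].
Qed.

Lemma measurable_close_step k : measurable_fun setT (close_step k).
Proof.
have mz : vec_measurable (fun s : state => sz s - alpha a L k.+1 *: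
    clip ((m k)%:R^-1 *: sg s) (B / alpha a L k.+1)).
  apply: vec_measurableB; first exact: vec_measurable_sz.
  apply: vec_measurableZc; apply: vec_measurable_clip; apply: vec_measurableZc.
  exact: vec_measurable_sg.
apply/measurable_fun_pair; [apply/measurable_fun_pair|].
- apply: measurable_vtuple; apply: vec_measurable_coupling => //.
  exact: vec_measurable_sy.
- exact: measurable_vtuple.
- exact: measurable_cst.
Qed.

Hypothesis mG : forall j : 'I_n, measurable_fun [set: n.-tuple R * Xi]
  (fun p : n.-tuple R * Xi => G (\row_i tnth p.1 i) p.2 0 j).

Lemma vec_measurable_oracle d (T : measurableType d) (v : T -> 'rV[R]_n) (x : T -> Xi) :
  vec_measurable v -> measurable_fun setT x -> vec_measurable (fun t => G (v t) (x t)).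
Proof.
move=> mv mx j.
rewrite (_ : (fun _ => _) = (fun p : n.-tuple R * Xi => G (\row_i tnth p.1 i) p.2 0 j) \o
    (fun t => (vtuple (v t), x t))).
  apply: (measurableT_comp (mG j)); apply/measurable_fun_pair => //.
  exact: measurable_vtuple.
by apply/funext => t /=; have := vtupleK (v t); rewrite /vrow => ->.
Qed.

Lemma measurable_sample_step k :
  measurable_fun [set: state * Xi] (fun p : state * Xi => sample_step k p.1 p.2).
Proof.
have m1 : measurable_fun [set: state * Xi] (fst : state * Xi -> state).
  exact: measurable_fst.
apply/measurable_fun_pair.
  exact: (measurableT_comp measurable_fst m1).
apply: measurable_vtuple; apply: vec_measurableD.
  exact: (vec_measurable_comp m1 vec_measurable_sg).
apply: vec_measurable_oracle; last exact: measurable_snd.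
exact: (vec_measurable_comp m1 (@vec_measurable_query k)).
Qed.

Definition sampled : set (nat * nat) := [set p | (p.1 < N)%N /\ (p.2 < m p.1)%N].

(** Sample [(k, i)] is included: it is the next one to be drawn from [trajectory k i]. *)
Definition future k i : set (nat * nat) :=
  [set p | sampled p /\ ((k < p.1)%N \/ (k = p.1 /\ (i <= p.2)%N))].

Hypothesis iid : iid_samples P D sampled (fun p : nat * nat => xi p.1 p.2).

Let X (p : nat * nat) := xi p.1 p.2.

Let mX k i p : future k i p -> measurable_fun setT (X p).
Proof. by move=> [sp _]; have [mX _ _] := iid; exact: mX. Qed.

Lemma fresh_trajectory_sample k i : (k < N)%N -> (i < m k)%N ->
  fresh P D X (trajectory k i) (future k i) ->
  fresh P D X (trajectory k i.+1) (future k i.+1).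
Proof.
move=> kN im fr.
have fki : future k i (k, i) by split=> //; right.
have frp := fresh_pair (@mX k i) fr fki.
have frs := fresh_comp (@measurable_sample_step k) frp.
rewrite (_ : trajectory k i.+1 = (fun p : state * Xi => sample_step k p.1 p.2) \o
    (fun w => (trajectory k i w, X (k, i) w))); last first.
  by apply/funext => w; rewrite trajectory_sample.
apply: fresh_sub frs => -[k' i'] [/= sp kp]; split.
  by split=> //; case: kp => [|[-> ii]]; [left|right; split=> //; exact: ltnW].
by move=> [kk ii]; move: kp; rewrite kk ii ltnn => -[//|[_]]; rewrite ltnn.
Qed.

Lemma fresh_trajectory k i : (k < N)%N -> (i <= m k)%N ->
  fresh P D X (trajectory k i) (future k i).
Proof.
have inner k' : (k' < N)%N -> fresh P D X (trajectory k' 0) (future k' 0) ->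
    forall j, (j <= m k')%N -> fresh P D X (trajectory k' j) (future k' j).
  move=> k'N fr0; elim=> // j IH jm.
  by apply: fresh_trajectory_sample => //; apply: IH; exact: ltnW.
elim: k i => [|k IHk] i kN im; apply: inner => //.
  rewrite (_ : trajectory 0 0 = fun=> (vtuple x0, vtuple x0, vtuple 0)).
    apply: (fresh_sub (J := sampled)); first by move=> p [].
    exact: fresh_cst.
  by apply/funext => w; rewrite /trajectory big_ord0.
have := fresh_comp (@measurable_close_step k) (IHk _ (ltnW kN) (leqnn _)).
rewrite (_ : _ \o _ = trajectory k.+1 0); last first.
  by apply/funext => w; rewrite trajectory_close.
apply: fresh_sub => -[k' i'] [sp kp]; split=> //; left.
by case: kp => [/ltnW//|[<-]].
Qed.

Lemma measurable_trajectory_last : measurable_fun setT (trajectory N 0).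
Proof.
case: N fresh_trajectory => [_|N' fr].
  rewrite (_ : trajectory 0 0 = fun=> (vtuple x0, vtuple x0, vtuple 0)).
    exact: measurable_cst.
  by apply/funext => w; rewrite /trajectory big_ord0.
have [mt _] := fr N' _ (ltnSn _) (leqnn _).
rewrite (_ : trajectory _ _ = close_step N' \o trajectory N' (m N')).
  exact: (measurableT_comp (@measurable_close_step N') mt).
by apply/funext => w; rewrite trajectory_close.
Qed.

Local Open Scope ereal_scope.

Lemma expect_sample_step k i (h h' : state -> R) : (k < N)%N -> (i < m k)%N ->
  measurable_fun setT h -> measurable_fun setT h' -> (forall s, 0 <= h s)%R ->
  (forall s, \int[D]_x (h (sample_step k s x))%:E <= (h' s)%:E) ->
  \int[P]_w (h (trajectory k i.+1 w))%:E <= \int[P]_w (h' (trajectory k i w))%:E.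
Proof.
move=> kN im mh mh' h0 hh'.
under eq_integral do rewrite trajectory_sample.
have fki : future k i (k, i) by split=> //; right.
apply: (fresh_step (@mX k i) (fresh_trajectory kN (ltnW im)) fki
  (h := fun p : state * Xi => (h (sample_step k p.1 p.2))%:E)
  (h' := fun s => (h' s)%:E)) => //.
- apply/measurable_EFinP; exact: (measurableT_comp mh (@measurable_sample_step k)).
- by move=> p; rewrite lee_fin.
- exact/measurable_EFinP.
Qed.

Lemma expect_close_step k (h h' : state -> R) : (k < N)%N ->
  measurable_fun setT h -> measurable_fun setT h' -> (forall s, 0 <= h s)%R ->
  (forall s, h (close_step k s) <= h' s)%R ->
  \int[P]_w (h (trajectory k.+1 0 w))%:E <= \int[P]_w (h' (trajectory k (m k) w))%:E.
Proof.
move=> kN mh mh' h0 hh'.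
have [mt _] := fresh_trajectory kN (leqnn _).
under eq_integral do rewrite trajectory_close.
apply: ge0_le_integral => //.
- by move=> w _; rewrite lee_fin.
- apply/measurable_EFinP; apply: (measurableT_comp mh).
  exact: (measurableT_comp (@measurable_close_step k) mt).
- apply/measurable_EFinP; exact: (measurableT_comp mh' mt).
- by move=> w _; rewrite lee_fin.
Qed.

End Chain.

(** * The supermartingale *)

Section Supermartingale.
Context {R : realType} {n : nat}.
Context {dO dX : measure_display} {Omega : measurableType dO} {Xi : measurableType dX}.
Variables (P : probability Omega R) (D : probability Xi R).
Variables (f : 'rV[R]_n -> R) (G : 'rV[R]_n -> Xi -> 'rV[R]_n).
Variables (L sigma a l R0 Rc : R) (m : nat -> nat) (N : nat).
Variables (x0 xstar : 'rV[R]_n) (xi : nat -> nat -> Omega -> Xi).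

Let B := Rc / (8 * l).
Let al k := alpha a L k.+1.
Let st := trajectory G L a B m x0 xi.
Let qu k (s : @state R n) := query L a k s.

Definition spotential k (s : @state R n) : R :=
  potential f xstar (Aseq a L k) (sy s) (sz s).

(** The potential controls [z] and the gap of [f] at [y], but not the distance of [y] to [xstar],
    which the gradient bound at the query point also uses. *)
Definition inball k (s : @state R n) : bool :=
  (norm2 (sy s - xstar) <= Rc) && (spotential k s <= Rc ^+ 2 / 2).

Definition weight k (s : @state R n) : R :=
  expR (tilt R0 l * (spotential k s - Rc ^+ 2 / 2)).

Definition psi k (s : @state R n) : R := if inball k s then weight k s else 1.

Definition noise_coef k := 12 * (l * (l / R0 ^+ 2)) * al k ^+ 2.

Definition sampling_error k i (s : @state R n) : 'rV[R]_n :=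
  (m k)%:R^-1 *: (sg s - i%:R *: grad f (qu k s)).

(* Bounds the conditional expectation, given the first [i] of the [m k] samples,
   of the quadratic in the sampling error that dominates the exponential of the
   potential increment. *)
Definition quad k i (s : @state R n) : R :=
  1 + dot ((tilt R0 l * al k) *: (xstar - sz s)) (sampling_error k i s)
    + noise_coef k * dot (sampling_error k i s) (sampling_error k i s)
    + noise_coef k * (((m k)%:R - i%:R) / (m k)%:R ^+ 2 * sigma ^+ 2).

(** Interpolates within an iteration: at [i = m k] it dominates the next [psi], and before any draw
    it is at most a constant times the current one. *)
Definition mid k i (s : @state R n) : R :=
  if inball k s then weight k s * quad k i s else 1.

Hypothesis fL : smooth f L.

Let msy := @vec_measurable_sy R n.
Let msz := @vec_measurable_sz R n.

Lemma measurable_spotential k : measurable_fun setT (spotential k).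
Proof.
apply: measurable_funD.
  apply: measurable_funM; first exact: measurable_cst.
  apply: measurable_funB; last exact: measurable_cst.
  exact: (measurable_smooth fL msy).
apply: measurable_funM; last exact: measurable_cst.
apply: measurable_funX; apply: measurable_norm2; apply: vec_measurableB => //.
Qed.

Lemma measurable_inball k : measurable_fun setT (inball k).
Proof.
apply: measurable_and; apply: measurable_fun_ler; [|exact: measurable_cst| |exact: measurable_cst].
  apply: measurable_norm2; apply: vec_measurableB => //; exact: vec_measurable_cst.
exact: measurable_spotential.
Qed.

Lemma measurable_weight k : measurable_fun setT (weight k).
Proof.
apply: measurableT_comp; first exact: measurable_expR.
apply: measurable_funM; first exact: measurable_cst.
by apply: measurable_funB; [exact: measurable_spotential|exact: measurable_cst].
Qed.

Lemma measurable_psi k : measurable_fun setT (psi k).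
Proof.
apply: measurable_fun_ifT; first exact: measurable_inball.
  exact: measurable_weight.
exact: measurable_cst.
Qed.

Lemma vec_measurable_error k i : vec_measurable (sampling_error k i).
Proof.
apply: vec_measurableZc; apply: vec_measurableB; first exact: vec_measurable_sg.
apply: vec_measurableZc; apply: (vec_measurable_grad fL).
exact: vec_measurable_query.
Qed.

Lemma measurable_mid k i : measurable_fun setT (mid k i).
Proof.
apply: measurable_fun_ifT; first exact: measurable_inball.
  apply: measurable_funM; first exact: measurable_weight.
  have me := @vec_measurable_error k i.
  apply: measurable_funD; last exact: measurable_cst.
  apply: measurable_funD.
    apply: measurable_funD; first exact: measurable_cst.
    apply: measurable_dot => //; apply: vec_measurableZc;
    by apply: vec_measurableB; [exact: vec_measurable_cst|exact: msz].
  by apply: measurable_funM; [exact: measurable_cst|exact: measurable_dot].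
exact: measurable_cst.
Qed.

Hypotheses (R00 : 0 < R0) (Rc0 : 0 < Rc) (RcE : Rc ^+ 2 = 5 * R0 ^+ 2) (l2 : 2 <= l).
Hypothesis L0 : 0 < L.
Hypothesis cf : convex_function [set: convex_lmodType 'rV[R]_n] f.
Hypothesis fmin : minimizer f xstar.
Hypothesis (Ak0 : forall k, 0 <= Aseq a L k) (al0 : forall k, 0 < al k).
Hypothesis alA : forall k, 2 * (L * al k ^+ 2) <= Aseq a L k + al k.
Hypothesis m0 : forall k, (k < N)%N -> (0 < m k)%N.
Hypothesis gradB : forall k s, (k < N)%N -> inball k s ->
  norm2 (grad f (qu k s)) <= B / al k / 2.
Hypothesis noiseB : forall k, (k < N)%N ->
  noise_coef k * (sigma ^+ 2 / (m k)%:R) <= l / (100 * N%:R).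
Hypothesis sgG : stochastic_gradient D f sigma G.

Lemma inball_z k s : inball k s -> norm2 (xstar - sz s) <= Rc.
Proof.
move=> /andP[_]; rewrite /spotential /potential => h.
rewrite -norm2N opprB -ler_sqr ?nnegrE ?norm2_ge0 ?(ltW Rc0)//.
have : 0 <= Aseq a L k * (f (sy s) - f xstar) by rewrite mulr_ge0// subr_ge0.
lra.
Qed.

Lemma noise_coef_ge0 k : 0 <= noise_coef k.
Proof.
have l0 : 0 <= l by have := l2; lra.
apply: mulr_ge0; last exact: sqr_ge0.
by rewrite !mulr_ge0// invr_ge0 sqr_ge0.
Qed.

Lemma weight_ge0 k s : 0 <= weight k s.
Proof. exact: expR_ge0. Qed.

Lemma tilt_gt0 : 0 < tilt R0 l.
Proof.
have l0 : 0 < l by have := l2; lra.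
by rewrite !mulr_gt0// invr_gt0 exprn_gt0.
Qed.

Lemma psi_ge0 k s : 0 <= psi k s.
Proof. by rewrite /psi; case: ifP => // _; exact: weight_ge0. Qed.

Lemma psi_le1 k s : psi k s <= 1.
Proof.
rewrite /psi; case: ifP => // /andP[_ h].
by rewrite -[leRHS]expR0 ler_expR pmulr_rle0 ?tilt_gt0// subr_le0.
Qed.

Lemma mid_ge0 k i s : (k < N)%N -> (i <= m k)%N -> 0 <= mid k i s.
Proof.
move=> kN im; rewrite /mid; case: ifP => // g; apply: mulr_ge0; first exact: weight_ge0.
apply: addr_ge0.
  apply: quadratic_ge0; exact: (tilt_sqr_le _ R00 Rc0 RcE l2 (inball_z g)).
apply: mulr_ge0; first exact: noise_coef_ge0.
by rewrite mulr_ge0 ?sqr_ge0// divr_ge0 ?sqr_ge0// subr_ge0 ler_nat.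
Qed.

(** A draw leaves [weight] and [inball] unchanged and adds a centred vector, divided by [m k], to
    the error. Its second moment is paid exactly by the decrease of the last term of [quad]. *)
Lemma mid_sample k i s : (k < N)%N -> (i < m k)%N ->
  (\int[D]_x (mid k i.+1 (sample_step G L a k s x))%:E <= (mid k i s)%:E)%E.
Proof.
move=> kN im.
have m1 : (m k)%:R != 0 :> R by rewrite pnatr_eq0 -lt0n m0.
have Vs x : spotential k (sample_step G L a k s x) = spotential k s by [].
have gs x : inball k (sample_step G L a k s x) = inball k s by [].
have ws x : weight k (sample_step G L a k s x) = weight k s by [].
rewrite /mid; under eq_integral do rewrite gs ws.
case: ifP => g; last first.
  rewrite integral_cst//= [X in (_ * X)%E](_ : _ = 1%E) ?mule1//.
  exact: probability_setT.
set W := weight k s; set q := qu k s; set M := (m k)%:R : R.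
set c := noise_coef k; set u := (tilt R0 l * al k) *: (xstar - sz s).
set e := sampling_error k i s.
have eE x : sampling_error k i.+1 (sample_step G L a k s x) = e + M^-1 *: (G q x - grad f q).
  rewrite /e /sampling_error /qu [query _ _ _ _]/(query L a k s) -/(qu k s) -/q.
  rewrite {1}/sg /sample_step /= vtupleK -scalerDr; congr (_ *: _).
  by apply/rowP => j; rewrite !mxE -natr1; ring.
have [mG EG VG] := sgG.
have mq : vec_measurable (G q).
  move=> j; exact: (vec_measurable_oracle (v := fun=> q) (x := idfun) mG
    (vec_measurable_cst q) (@measurable_id _ Xi setT) j).
(* The linear coefficient collects [u] and the cross term of the squared error. *)
have := @expect_quadratic_le _ _ _ _ D (G q) (grad f q)
  (W *: (M^-1 *: u + (2 * c * M^-1) *: e)) sigma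
  (W * (1 + dot u e + c * dot e e + c * ((M - i.+1%:R) / M ^+ 2 * sigma ^+ 2)))
  (W * (c * M^-1 ^+ 2)) mq (EG q) (VG q).
have cW : 0 <= W * (c * M^-1 ^+ 2).
  by rewrite mulr_ge0 ?weight_ge0// mulr_ge0 ?noise_coef_ge0// sqr_ge0.
move=> /(_ cW).
rewrite (_ : W * _ + W * _ * sigma ^+ 2 = W * quad k i s); last first.
  rewrite /quad -/e -/M -/c -/u -natr1; field.
  exact: m1.
apply: le_trans; rewrite le_eqVlt; apply/orP; left; apply/eqP.
apply: eq_integral => x _; congr EFin.
rewrite /quad eE -/M -/c [sz _]/(sz s) -/u; set z := G q x - grad f q.
clearbody z e u; rewrite !dotE (dotC z e); ring.
Qed.

Lemma mid_close k s : (k < N)%N ->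
  psi k.+1 (close_step L a B m k s) <= mid k (m k) s.
Proof.
move=> kN; rewrite /mid; case: ifP => g; last exact: psi_le1.
have m1 : (m k)%:R != 0 :> R by rewrite pnatr_eq0 -lt0n m0.
set g' := (m k)%:R^-1 *: sg s.
have eE : sampling_error k (m k) s = g' - grad f (qu k s).
  by rewrite /sampling_error scalerBr scalerA mulVf// scale1r.
rewrite /quad subrr mul0r mul0r mulr0 addr0 eE.
have wR := inball_z g.
have := exp_noise_le R00 Rc0 RcE l2 (al0 k) g' (gradB kN g) wR; cbv zeta.
rewrite -/B -/(noise_coef k) => h.
apply: le_trans (ler_wpM2l (weight_ge0 _ _) h).
rewrite /weight -expRD -mulrDr.
set theta := clip g' _ - _.
have V1 : spotential k.+1 (close_step L a B m k s) <= spotential k s +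
    (al k * dot theta (xstar - sz s) + al k ^+ 2 * dot theta theta).
  have := potential_step xstar L0 fL cf (sy s) (sz s) (clip g' (B / al k)) (Ak0 k) (al0 k) (alA k).
  by cbv zeta; rewrite /spotential /close_step /sy /sz /= !vtupleK.
rewrite /psi; case: ifPn => [_|ng].
  by rewrite ler_expR ler_wpM2l ?(ltW tilt_gt0)//; lra.
(* Outside the region the new value is 1, so it suffices that the new potential has reached
   [Rc ^+ 2 / 2]. *)
rewrite -[leLHS]expR0 ler_expR mulr_ge0 ?(ltW tilt_gt0)//.
suff : Rc ^+ 2 / 2 <= spotential k.+1 (close_step L a B m k s) by lra.
(* The ball condition cannot fail alone: a small potential puts the new [z] in the ball, and the new
   [y] is a convex combination of it and the old [y]. *)
rewrite leNgt; apply: contra ng => Vlt; rewrite /inball (ltW Vlt) andbT.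
have zR : norm2 (sz (close_step L a B m k s) - xstar) <= Rc.
  rewrite -ler_sqr ?nnegrE ?norm2_ge0 ?(ltW Rc0)//.
  move: Vlt; rewrite /spotential /potential.
  have : 0 <= Aseq a L k.+1 * (f (sy (close_step L a B m k s)) - f xstar).
    by rewrite mulr_ge0// subr_ge0.
  lra.
have /andP[yR _] := g.
have A1 : 0 < Aseq a L k + al k by rewrite ltr_wpDl.
have -> : sy (close_step L a B m k s) - xstar = (Aseq a L k / (Aseq a L k + al k)) *: (sy s - xstar)
    + (al k / (Aseq a L k + al k)) *: (sz (close_step L a B m k s) - xstar).
  rewrite /close_step /sy /sz /= !vtupleK /coupling -/(al k).
  move: (_ - al k *: _) => z'; apply/rowP => j; rewrite !mxE.
  rewrite -!/(al k) -![k.+2%:R / (2 * a * L)]/(al k).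
  by field; rewrite gt_eqF.
apply: le_trans (norm2_convex_le _ _ yR zR) _.
- by rewrite divr_ge0// ltW.
- by rewrite divr_ge0// ltW.
by rewrite -mulrDl divff ?mul1r// gt_eqF.
Qed.

Lemma mid_open k s : (k < N)%N -> sg s = 0 ->
  mid k 0 s <= (1 + l / (100 * N%:R)) * psi k s.
Proof.
move=> kN sg0; rewrite /mid /psi.
have l0 : 0 <= l by have := l2; lra.
have r0 : 0 <= l / (100 * N%:R) by rewrite divr_ge0// mulr_ge0.
case: ifP => g; last by rewrite mulr1 lerDl.
rewrite mulrC ler_wpM2r ?weight_ge0//.
have m1 : (m k)%:R != 0 :> R by rewrite pnatr_eq0 -lt0n m0.
rewrite /quad /sampling_error sg0 scale0r subrr scaler0.
have d0 (v : 'rV[R]_n) : dot v 0 = 0 by rewrite -(scale0r v) dotZr mul0r.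
rewrite !d0 mulr0 !addr0 lerD2l; apply: le_trans (noiseB kN).
rewrite subr0 le_eqVlt; apply/orP; left; apply/eqP; congr (_ * _).
by field.
Qed.

Hypothesis iid : iid_samples P D (sampled m N) (fun p : nat * nat => xi p.1 p.2).
Local Open Scope ereal_scope.

Lemma expect_psi_step k : (k < N)%N ->
  \int[P]_w (psi k.+1 (st k.+1 0 w))%:E <=
  (1 + l / (100 * N%:R))%:E * \int[P]_w (psi k (st k 0 w))%:E.
Proof.
move=> kN; have [mG _ _] := sgG.
have h := expect_close_step x0 mG iid kN (@measurable_psi k.+1)
  (@measurable_mid k (m k)) (psi_ge0 k.+1) (fun s => mid_close s kN).
apply: le_trans h _.
have mids i : (i <= m k)%N -> \int[P]_w (mid k i (st k i w))%:E <=
    \int[P]_w (mid k 0 (st k 0 w))%:E.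
  elim: i => // i IH im; apply: le_trans (IH (ltnW im)).
  apply: (expect_sample_step B x0 mG iid kN im (@measurable_mid k i.+1)
    (@measurable_mid k i)) => [s|s]; last exact: mid_sample.
  exact: mid_ge0.
apply: le_trans (mids _ (leqnn _)) _.
have l0 : (0 <= l)%R by have := l2; lra.
have r0 : (0 <= 1 + l / (100 * N%:R))%R.
  by rewrite addr_ge0// divr_ge0// mulr_ge0.
have [mt _] := fresh_trajectory L a B x0 mG iid kN (leq0n _).
rewrite -ge0_integralZl//; last 2 first.
- by apply/measurable_EFinP; exact: (measurableT_comp (@measurable_psi k) mt).
- by move=> w _; rewrite lee_fin psi_ge0.
apply: ge0_le_integral => //.
- by move=> w _; rewrite lee_fin mid_ge0.
- by apply/measurable_EFinP; exact: (measurableT_comp (@measurable_mid k 0) mt).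
- apply/measurable_EFinP; apply: measurable_funM; first exact: measurable_cst.
  exact: (measurableT_comp (@measurable_psi k) mt).
move=> w _; rewrite -EFinM lee_fin; apply: mid_open => //.
by rewrite /sg /st /trajectory /= vtupleK big_ord0.
Qed.

Hypothesis start : (norm2 (x0 - xstar) = R0)%R.

Lemma expect_psi k : (k <= N)%N -> \int[P]_w (psi k (st k 0 w))%:E <=
  (expR (k%:R * (l / (100 * N%:R))) * expR (- (3 / 2 * l)))%:E.
Proof.
elim: k => [_|k IH kN].
  rewrite mul0r expR0 mul1r.
  have start_psi w : (psi 0 (st 0 0 w) = expR (- (3 / 2 * l)))%R.
    have V0 : (spotential 0 (st 0 0 w) = R0 ^+ 2 / 2)%R.
      by rewrite /spotential /potential /st /trajectory /sy /sz /= !vtupleK mul0r add0r start.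
    have g0 : inball 0 (st 0 0 w).
      rewrite /inball V0 RcE; apply/andP; split; last by have := sqr_ge0 R0; lra.
      rewrite /st /trajectory /sy /= vtupleK start -ler_sqr ?nnegrE ?(ltW Rc0) ?(ltW R00)// RcE.
      by have := sqr_ge0 R0; lra.
    rewrite /psi g0 /weight V0 RcE /tilt; congr expR; field.
    by rewrite gt_eqF.
  under eq_integral do rewrite start_psi.
  rewrite integral_cst//= [X in _ * X](_ : _ = 1) ?mule1//; exact: probability_setT.
apply: le_trans (expect_psi_step kN) _.
have l0 : (0 <= l)%R by have := l2; lra.
have r0 : (0 <= l / (100 * N%:R))%R by rewrite divr_ge0// mulr_ge0.
apply: (@le_trans _ _ ((expR (l / (100 * N%:R)))%:E * \int[P]_w (psi k (st k 0 w))%:E)).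
  apply: lee_wpmul2r; first by apply: integral_ge0 => w _; rewrite lee_fin psi_ge0.
  by rewrite lee_fin expR_ge1Dx.
have e0 : 0 <= (expR (l / (100 * N%:R)))%:E by rewrite lee_fin expR_ge0.
apply: le_trans (lee_wpmul2l e0 (IH (ltnW kN))) _.
rewrite -EFinM lee_fin; move: (l / _)%R => r.
have -> : (k.+1%:R * r = r + k%:R * r)%R by rewrite -natr1 mulrDl mul1r addrC.
by rewrite mulrA -(expRD r).
Qed.

Lemma potential_tail : (0 < N)%N ->
  P [set w | (Rc ^+ 2 / 2 < spotential N (st N 0 w))%R] <= (expR (- l))%:E.
Proof.
move=> N0; have [mG _ _] := sgG.
have mt := measurable_trajectory_last L a B x0 mG iid.
have mV := measurableT_comp (@measurable_spotential N) mt.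
set E := [set w | _].
have mE : measurable E.
  rewrite -[X in measurable X]setTI.
  have mb := measurable_fun_ltr (measurable_cst (Rc ^+ 2 / 2)%R) mV.
  exact: (mb measurableT [set true] _).
rewrite -[X in P X]setIT -integral_indic//.
apply: (@le_trans _ _ (\int[P]_w (psi N (st N 0 w))%:E)).
  apply: ge0_le_integral => //.
  - by apply/measurable_EFinP; exact: measurable_indic.
  - by apply/measurable_EFinP; exact: (measurableT_comp (@measurable_psi N) mt).
  (* On [E] the state is outside the region, so [psi] is 1 there: Markov's inequality. *)
  move=> w _; rewrite lee_fin indicE; case: (boolP (w \in E)) => [/set_mem wE|_].
    have {}wE : (Rc ^+ 2 / 2 < spotential N (st N 0 w))%R by exact: wE.
    by rewrite /psi /inball [X in _ && X]leNgt wE andbF.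
  exact: psi_ge0.
apply: le_trans (expect_psi (leqnn _)) _.
rewrite lee_fin -expRD ler_expR.
have -> : (N%:R * (l / (100 * N%:R)) = l / 100)%R.
  by field; rewrite pnatr_eq0 -lt0n.
by have := l2; lra.
Qed.

End Supermartingale.

(** * The parameters *)

Section Tuning.
Context {R : realType}.
Variables (L sigma R0 beta : R) (N : nat).
Hypotheses (L0 : 0 < L) (sigma0 : 0 <= sigma) (R00 : 0 < R0).

Let l := logfactor beta N.
Let a := step_param L sigma R0 beta N.
Hypothesis l2 : 2 <= l.

Let l0 : 0 < l. Proof. exact: lt_le_trans l2. Qed.

Lemma Cconst_gt0 : 0 < Cconst R.
Proof. by rewrite sqrtr_gt0. Qed.

Lemma sqr_Cconst : Cconst R ^+ 2 = 5.
Proof. by rewrite sqr_sqrtr. Qed.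

(* The third term of [a'] is the square of the larger root of
   [s^2 - 24 l s - 72 l], so that this quadratic is nonnegative at [sqrt a]. *)
Lemma step_param_root : 24 * l * Num.sqrt a + 72 * l <= a.
Proof.
have lS : 0 <= 4 * l ^+ 2 + 2 * l by rewrite addr_ge0 ?mulr_ge0 ?sqr_ge0// ltW.
set q := Num.sqrt (4 * l ^+ 2 + 2 * l).
have qE : q ^+ 2 = 4 * l ^+ 2 + 2 * l by rewrite sqr_sqrtr.
have q0 : 0 <= q by exact: sqrtr_ge0.
have ale : 36 * (2 * l + q) ^+ 2 <= a.
  by rewrite /a /step_param /step_param' -/l -/q !le_max lexx !orbT.
have a0 : 0 <= a by apply: le_trans ale; rewrite mulr_ge0 ?sqr_ge0.
set s := Num.sqrt a.
have sE : s ^+ 2 = a by rewrite sqr_sqrtr.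
have s0 : 0 <= s by exact: sqrtr_ge0.
have sq : 6 * (2 * l + q) <= s.
  have w0 : 0 <= 6 * (2 * l + q) by rewrite mulr_ge0// addr_ge0// mulr_ge0// ltW.
  by rewrite -ler_sqr ?nnegrE// sE; lra.
have : 0 <= (s - 12 * l - 6 * q) * (s - 12 * l + 6 * q).
  by have := ltW l0; rewrite mulr_ge0//; lra.
rewrite -sE; lra.
Qed.

Let s := Num.sqrt a.

Lemma step_param_ge1 : 1 <= a.
Proof. by rewrite /a /step_param /step_param' !le_max lexx. Qed.

Let a0 : 0 < a. Proof. exact: lt_le_trans step_param_ge1. Qed.

Let sE : s ^+ 2 = a. Proof. by rewrite sqr_sqrtr// ltW. Qed.

Let s1 : 1 <= s. Proof. by rewrite -sqrtr1 ler_wsqrtr// step_param_ge1. Qed.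

Lemma step_param_ge : 96 * l <= a.
Proof.
have := step_param_root; rewrite -/s.
have : l * 1 <= l * s by rewrite ler_wpM2l// ltW.
lra.
Qed.

Lemma AseqE k : Aseq a L k = k%:R * (k%:R + 3) / (4 * a * L).
Proof.
elim: k => [|k IH] /=; first by rewrite !mul0r.
rewrite IH -(natr1 k) -(natr1 k.+1) -(natr1 k).
by field; rewrite !gt_eqF.
Qed.

Lemma alphaE k : alpha a L k.+1 = (k%:R + 2) / (2 * a * L).
Proof. by rewrite /alpha -(natr1 k.+1) -(natr1 k) -addrA. Qed.

Lemma Aseq_ge0 k : 0 <= Aseq a L k.
Proof. by rewrite AseqE divr_ge0 ?mulr_ge0 ?addr_ge0// ltW. Qed.

Lemma alpha_gt0 k : 0 < alpha a L k.+1.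
Proof. by rewrite alphaE divr_gt0 ?mulr_gt0// ltr_wpDl. Qed.

Lemma LalphaE k : L * alpha a L k.+1 ^+ 2 = (k%:R + 2) ^+ 2 / (4 * a ^+ 2 * L).
Proof. by rewrite alphaE; field; rewrite !gt_eqF. Qed.

Lemma Lalpha_le k : L * alpha a L k.+1 ^+ 2 <= a^-1 * Aseq a L k.+1.
Proof.
rewrite LalphaE AseqE -(natr1 k).
have -> : a^-1 * ((k%:R + 1) * (k%:R + 1 + 3) / (4 * a * L)) =
    ((k%:R + 1) * (k%:R + 1 + 3)) / (4 * a ^+ 2 * L) by field; rewrite !gt_eqF.
rewrite ler_pM2r ?invr_gt0 ?mulr_gt0 ?exprn_gt0//.
have : 0 <= k%:R :> R by []. nra.
Qed.

(** Comes down to [(k + 2)^2 <= 9/4 k (k + 3)], an equality at [k = 1], whence the 3/2; at [k = 0]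
    the right-hand side vanishes. *)
Lemma Lalpha_le_prev k : (0 < k)%N ->
  L * alpha a L k.+1 ^+ 2 <= (3 / (2 * s)) ^+ 2 * Aseq a L k.
Proof.
move=> k0; rewrite LalphaE AseqE.
have -> : (3 / (2 * s)) ^+ 2 = 9 / (4 * a).
  by rewrite -sE; field; rewrite gt_eqF// (lt_le_trans _ s1).
have -> : 9 / (4 * a) * (k%:R * (k%:R + 3) / (4 * a * L)) =
    (9 / 4 * (k%:R * (k%:R + 3))) / (4 * a ^+ 2 * L) by field; rewrite !gt_eqF.
rewrite ler_pM2r ?invr_gt0 ?mulr_gt0 ?exprn_gt0//.
have : 1 <= k%:R :> R by rewrite ler1n. nra.
Qed.

Lemma Lalpha2_le k : 2 * (L * alpha a L k.+1 ^+ 2) <= Aseq a L k + alpha a L k.+1.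
Proof.
rewrite -[leRHS]/(Aseq a L k.+1).
apply: (@le_trans _ _ (2 * (a^-1 * Aseq a L k.+1))).
  by rewrite ler_wpM2l// Lalpha_le.
rewrite mulrA ler_piMl ?Aseq_ge0//.
by rewrite ler_pdivrMr// mul1r; have := step_param_ge; have := l2; lra.
Qed.

Let Rc := Cconst R * R0.

Lemma Rc_gt0 : 0 < Rc. Proof. by rewrite mulr_gt0 ?Cconst_gt0. Qed.

Lemma sqr_Rc : Rc ^+ 2 = 5 * R0 ^+ 2.
Proof. by rewrite exprMn sqr_Cconst. Qed.

(** With [c = a^-1] and [d = 3 / (2 sqrt a)], [grad_coupling_le] reduces the claim to
    [32 l + 24 l sqrt a <= a], supplied by [step_param_root]. At [k = 0] the query point is [z], and
    [16 l <= a] suffices. *)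
Lemma grad_query_le (n : nat) (f : 'rV[R]_n -> R) (xstar : 'rV[R]_n) k st :
  smooth f L -> minimizer f xstar ->
  inball f L a Rc xstar k st ->
  norm2 (grad f (query L a k st)) <= Rc / (8 * l) / alpha a L k.+1 / 2.
Proof.
move=> fL fmin /[dup] g /andP[yR V].
have al0 := alpha_gt0 k; have Rc0 := Rc_gt0.
rewrite ler_pdivlMr// ler_pdivlMr//.
have alB : norm2 (grad f (query L a k st)) * 2 * alpha a L k.+1 =
  2 * (alpha a L k.+1 * norm2 (grad f (query L a k st))) by ring.
rewrite alB {alB}.
have BE : Rc / (8 * l) = 2 * (1 / (16 * l) * Rc) by field; rewrite gt_eqF.
rewrite BE ler_pM2l//.
have [k0|k0] := posnP k.
  move: g V al0; rewrite k0 => g V al0.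
  have -> : query L a 0 st = sz st.
    rewrite /query /coupling /= add0r scale0r add0r scalerA mulVf ?scale1r//.
    by rewrite gt_eqF// -[_ / _]/(alpha a L 1).
  have zR := inball_z Rc_gt0 fmin Aseq_ge0 g.
  apply: (@le_trans _ _ (alpha a L 1 * (L * Rc))).
    rewrite ler_wpM2l// ?(ltW al0)//; apply: le_trans (grad_le_dist L0 fL fmin _) _.
    by rewrite ler_wpM2l ?(ltW L0)// -norm2N opprB.
  have -> : alpha a L 1 * (L * Rc) = a^-1 * Rc.
    by rewrite alphaE; field; rewrite !gt_eqF.
  rewrite ler_wpM2r ?(ltW Rc0)// div1r lef_pV2 ?posrE ?mulr_gt0//.
  by have := step_param_ge; have := l0; lra.
have Ak0 : 0 < Aseq a L k.
  by rewrite AseqE divr_gt0 ?mulr_gt0// ?ltr0n// ltr_wpDl.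
have s0 : 0 < s by exact: lt_le_trans s1.
have d0 : 0 <= 3 / (2 * s) by rewrite divr_ge0// mulr_ge0// ltW.
have h := grad_coupling_le L0 fL fmin Ak0 al0 (ltW Rc0) d0 yR V (Lalpha_le k) (Lalpha_le_prev k0).
apply: le_trans h _; rewrite ler_wpM2r ?(ltW Rc0)//.
have -> : 2 * a^-1 + 3 / (2 * s) = (32 * l + 24 * l * s) / (16 * l * a).
  by rewrite -sE; field; rewrite !gt_eqF.
have -> : 1 / (16 * l) = a / (16 * l * a) by field; rewrite !gt_eqF.
rewrite ler_pM2r ?invr_gt0 ?mulr_gt0//.
by have := step_param_root; rewrite -/s; have := l0; lra.
Qed.

Let m := batchsize L sigma R0 beta N.

Let X k := 6000 * sigma ^+ 2 * alpha a L k.+1 ^+ 2 * N%:R * l / (Cconst R ^+ 2 * R0 ^+ 2).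
Let Y k := 10368 * sigma ^+ 2 * alpha a L k.+1 ^+ 2 * N%:R / (Cconst R ^+ 2 * R0 ^+ 2).

Let batchsizeE k : exists2 z : R, (m k)%:R = z &
  Num.max 1 (Num.max (X k) (Y k)) <= z < Num.max 1 (Num.max (X k) (Y k)) + 1.
Proof.
exists (m k)%:R => //; set M := Num.max 1 _.
have M1 : 1 <= M by rewrite le_max lexx.
have c0 : 0 <= Num.ceil M by rewrite ceil_ge0; apply: lt_le_trans M1; lra.
have -> : (m k)%:R = (Num.ceil M)%:~R :> R.
  by rewrite /m /batchsize -/a -/l -/(X k) -/(Y k) -/M -[in RHS](gez0_abs c0).
by have /andP[h1 ->] := ceil_itv M; rewrite -ltrBlDr -[1]/(1%:~R) -intrB.
Qed.

Lemma batchsize_gt0 k : (0 < m k)%N.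
Proof.
have [z mz /andP[h _]] := batchsizeE k.
rewrite -(ltr0n R) mz; apply: lt_le_trans h; by rewrite lt_max ltr01.
Qed.

Lemma batchsize_ge k : X k <= (m k)%:R.
Proof.
by have [z -> /andP[h _]] := batchsizeE k; apply: le_trans h; rewrite !le_max lexx orbT.
Qed.

(** The 100 is [6000 / (12 * 5)]: the first batchsize formula gives equality. *)
Lemma noise_coef_le k : (0 < N)%N ->
  noise_coef L a l R0 k * (sigma ^+ 2 / (m k)%:R) <= l / (100 * N%:R).
Proof.
move=> N0; have m0 : 0 < (m k)%:R :> R by rewrite ltr0n batchsize_gt0.
have N1 : 0 < N%:R :> R by rewrite ltr0n.
rewrite mulrA ler_pdivrMr//.
apply: le_trans (ler_wpM2l _ (batchsize_ge k)); last by rewrite divr_ge0 ?mulr_ge0// ltW.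
rewrite /X /noise_coef sqr_Cconst le_eqVlt; apply/orP; left; apply/eqP.
by field; rewrite !gt_eqF.
Qed.

Lemma sqr_noise_le : sigma ^+ 2 * N%:R ^+ 3 * l <= (a * L * R0) ^+ 2.
Proof.
have pE : (N%:R `^ (3 / 2)) ^+ 2 = N%:R ^+ 3 :> R.
  rewrite -powR_mulrn ?powR_ge0// -powRrM (_ : 3 / 2 * 2%:R = 3%:R); last by field.
  by rewrite powR_mulrn.
have lE : Num.sqrt l ^+ 2 = l by rewrite sqr_sqrtr// ltW.
rewrite -pE -[X in _ * X <= _]lE -!exprMn.
have LR : 0 < L * R0 by rewrite mulr_gt0.
rewrite ler_pXn2r ?nnegrE ?mulr_ge0 ?powR_ge0 ?sqrtr_ge0 ?(ltW L0) ?(ltW a0) ?(ltW R00)//.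
rewrite -[a * L * R0]mulrA -ler_pdivrMr//.
rewrite [leLHS](_ : _ = sigma * N%:R `^ (3 / 2) / (L * R0) * Num.sqrt l).
  by rewrite /a /step_param le_max lexx orbT.
by field; rewrite !gt_eqF.
Qed.

(** The second term of [a] makes [t N l] at most 1, so the two formulas are at most 1200 and, as
    [l >= 2], 5184/5. *)
Lemma batchsize_le k : (k < N)%N -> (m k)%:R <= 2300 :> R.
Proof.
move=> kN; have N1 : 1 <= N%:R :> R by rewrite ler1n (leq_trans _ kN).
have k1 : k%:R + 1 <= N%:R :> R by rewrite natr1 ler_nat.
have k0 : 0 <= k%:R :> R by [].
set t := sigma ^+ 2 * alpha a L k.+1 ^+ 2 / R0 ^+ 2.
have aLR : 0 < (a * L * R0) ^+ 2 by rewrite exprn_gt0// !mulr_gt0.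
have t0 : 0 <= t by apply: divr_ge0; [apply: mulr_ge0|]; exact: sqr_ge0.
have tE : t * (a * L * R0) ^+ 2 = sigma ^+ 2 * ((k%:R + 2) / 2) ^+ 2.
  by rewrite /t alphaE; field; rewrite !gt_eqF.
have tN : t * N%:R * l <= 1.
  rewrite -(ler_pM2r aLR) mul1r; apply: le_trans sqr_noise_le.
  rewrite [leLHS](_ : _ = t * (a * L * R0) ^+ 2 * (N%:R * l)); last by ring.
  rewrite tE [leRHS](_ : _ = sigma ^+ 2 * N%:R ^+ 2 * (N%:R * l)); last by ring.
  rewrite ler_wpM2r ?mulr_ge0// ?(ltW l0)// ler_wpM2l ?sqr_ge0//.
  by rewrite ler_pXn2r ?nnegrE//; lra.
have XE : X k = 1200 * (t * N%:R * l).
  by rewrite /X /t sqr_Cconst; field; rewrite gt_eqF.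
have YE : Y k = 10368 / 5 * (t * N%:R).
  by rewrite /Y /t sqr_Cconst; field; rewrite gt_eqF.
have tN2 : t * N%:R * 2 <= t * N%:R * l by rewrite ler_wpM2l// mulr_ge0.
have tN0 : 0 <= t * N%:R by rewrite mulr_ge0.
have [z -> /andP[_ h]] := batchsizeE k; apply: (le_trans (ltW h)).
rewrite -lerBrDr !ge_max XE YE; apply/andP; split; last apply/andP; last split; lra.
Qed.

Lemma oracle_calls_le : (oracle_calls L sigma R0 beta N)%:R <= 2300 * N%:R :> R.
Proof.
rewrite /oracle_calls natr_sum; apply: (@le_trans _ _ (\sum_(k < N) (2300 : R))).
  by apply: ler_sum => k _; exact: batchsize_le.
by rewrite sumr_const card_ord mulr_natr.
Qed.

(** For [l >= 2] the square root is at most [9/4 l], and [6 * 17/4] is below 26. *)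
Lemma step_param'_le : step_param' beta N <= (26 * l) ^+ 2.
Proof.
have ll : 2 * l <= l ^+ 2 by rewrite expr2 ler_wpM2r// ltW.
have lb := l2.
have C1 : 2 <= Cconst R.
  by rewrite -ler_sqr ?nnegrE ?(ltW Cconst_gt0)// sqr_Cconst; lra.
rewrite /step_param' -/l !ge_max; apply/andP; split; first lra.
apply/andP; split.
  rewrite ler_pdivrMr ?Cconst_gt0//.
  have : (26 * l) ^+ 2 * 2 <= (26 * l) ^+ 2 * Cconst R.
    by apply: ler_wpM2l C1; exact: sqr_ge0.
  lra.
have q1 : Num.sqrt (4 * l ^+ 2 + 2 * l) <= 9 / 4 * l.
  have w0 : 0 <= 9 / 4 * l by rewrite mulr_ge0// ltW.
  rewrite -ler_sqr ?nnegrE ?sqrtr_ge0// sqr_sqrtr; lra.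
have q0 := sqrtr_ge0 (4 * l ^+ 2 + 2 * l).
have : (2 * l + Num.sqrt (4 * l ^+ 2 + 2 * l)) ^+ 2 <= (17 / 4 * l) ^+ 2.
  by rewrite ler_pXn2r ?nnegrE//; lra.
lra.
Qed.

(* [10 a L R0^2 <= eps N^2] is the accuracy obtained from the potential bound
   [5 R0^2 / 2]; each of the two terms of [a] gives one condition on [N]. *)
Lemma accuracy (eps u : R) : 0 < eps -> (0 < N)%N ->
  L * R0 ^+ 2 / eps <= u ^+ 2 -> 0 <= u -> sigma ^+ 2 * R0 ^+ 2 / eps ^+ 2 <= u ->
  100 * u * l <= N%:R ->
  10 * a * L * R0 ^+ 2 <= eps * N%:R ^+ 2.
Proof.
move=> e0 N0 h1 u0 h2 h3.
have N1 : 0 < N%:R :> R by rewrite ltr0n.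
rewrite ler_pdivrMr// in h1; rewrite ler_pdivrMr ?exprn_gt0// in h2.
have LR : 0 < L * R0 ^+ 2 by rewrite mulr_gt0 ?exprn_gt0.
have [ha|ha] : a = step_param' beta N \/ a = sigma * (N%:R `^ (3 / 2)) / (L * R0) * Num.sqrt l.
- by rewrite /a /step_param /Num.max; case: ifP => _; [right|left].
- have h4 : a <= (26 * l) ^+ 2 by rewrite ha step_param'_le.
  have h5 : (100 * u * l) ^+ 2 <= N%:R ^+ 2.
    by rewrite ler_pXn2r ?nnegrE// ?mulr_ge0// ltW.
  have h6 := ler_wpM2r (ltW LR) h4.
  have h7 : l ^+ 2 * (L * R0 ^+ 2) <= l ^+ 2 * (u ^+ 2 * eps) by rewrite ler_wpM2l ?sqr_ge0.
  have h8 := ler_wpM2l (ltW e0) h5.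
  have h9 : 0 <= l ^+ 2 * (u ^+ 2 * eps) by rewrite !mulr_ge0 ?sqr_ge0// ltW.
  lra.
have sN0 : 0 <= sigma * N%:R `^ (3 / 2) * Num.sqrt l * R0.
  by rewrite !mulr_ge0 ?powR_ge0 ?sqrtr_ge0// ltW.
rewrite [leLHS](_ : _ = 10 * (sigma * N%:R `^ (3 / 2) * Num.sqrt l * R0)); last first.
  by rewrite ha; field; rewrite !gt_eqF.
rewrite -ler_sqr ?nnegrE; first last.
- by apply: mulr_ge0; [exact: ltW|exact: sqr_ge0].
- by apply: mulr_ge0 => //; lra.
have pE : (N%:R `^ (3 / 2)) ^+ 2 = N%:R ^+ 3 :> R.
  rewrite -powR_mulrn ?powR_ge0// -powRrM (_ : 3 / 2 * 2%:R = 3%:R); last by field.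
  by rewrite powR_mulrn.
have lE : Num.sqrt l ^+ 2 = l by rewrite sqr_sqrtr// ltW.
(* Squaring turns the factor 10 into the 100 of [100 * u * l <= N%:R]; the other case has slack. *)
rewrite [leLHS](_ : _ = 100 * (sigma ^+ 2 * R0 ^+ 2) * (N%:R ^+ 3 * l)); last first.
  by rewrite -[in RHS]lE -pE; ring.
have N3 : 0 <= N%:R ^+ 3 * l by rewrite mulr_ge0 ?exprn_ge0// ltW.
have h4 := ler_wpM2r N3 h2.
have h5 : eps ^+ 2 * N%:R ^+ 3 * (100 * u * l) <= eps ^+ 2 * N%:R ^+ 3 * N%:R.
  by rewrite ler_wpM2l// mulr_ge0 ?exprn_ge0// ltW.
lra.
Qed.

End Tuning.

(** * Counting iterations *)

Section Complexity.
Context {R : realType}.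

Lemma expR2_le16 : expR 2 <= 16 :> R.
Proof.
have h : expR (2^-1) <= 2 :> R.
  have e0 : 0 < expR (2^-1) :> R by exact: expR_gt0.
  have : 2^-1 <= expR (- 2^-1) :> R by apply: le_trans (expR_ge1Dx _); lra.
  rewrite expRN => h; rewrite -(invrK (expR _)) -[leRHS]invrK lef_pV2 ?posrE ?invr_gt0//.
have -> : expR 2 = expR (2^-1) ^+ 4 :> R.
  by rewrite !exprS expr0 mulr1 -!expRD; congr expR; field.
apply: (@le_trans _ _ (2 ^+ 4)); last by lra.
by rewrite ler_pXn2r ?nnegrE ?expR_ge0.
Qed.

Lemma expR10_ge : 800 <= expR 10 :> R.
Proof.
have h : 2 <= expR 1 :> R by apply: le_trans (expR_ge1Dx _); lra.
have -> : expR 10 = expR 1 ^+ 10 :> R by rewrite -expRM_natl mulr1.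
apply: (@le_trans _ _ (2 ^+ 10)); first lra.
by rewrite ler_pXn2r ?nnegrE ?expR_ge0.
Qed.

Lemma ln_le_sub1 (x : R) : 0 < x -> ln x <= x - 1.
Proof.
by move=> x0; have := expR_ge1Dx (ln x); rewrite lnK ?posrE//; lra.
Qed.

(** The tangent of [ln] at [w], without its term -1. A large [w] makes the slope small enough to be
    absorbed by [N]. *)
Lemma ln_le_affine (w x : R) : 0 < w -> 0 < x -> ln x <= x / w + ln w.
Proof.
move=> w0 x0; have := ln_le_sub1 (divr_gt0 x0 w0); rewrite ln_div ?posrE//; lra.
Qed.

Variables (delta gamma beta : R).
Hypotheses (delta0 : 0 < delta) (gamma0 : 0 <= gamma) (beta01 : 0 < beta < 1).

Let u := Num.max (Num.sqrt delta) (gamma ^+ 2).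
Let s := delta + gamma.

Lemma rate_gt0 : 0 < u.
Proof. by rewrite lt_max sqrtr_gt0 delta0. Qed.

(* Either [u beta <= s^2], which makes [ln (u / beta)] at most [2 ln (s / beta)],
   or [s] is so small that [u^4 < beta] and [u ln (1 / beta)] is bounded. *)
Lemma rate_log_le :
  u * ln (expR 10 * u / beta) <= 192 * Num.max 1 (u * ln (s / beta)).
Proof.
have /andP[b0 b1] := beta01; have u0 := rate_gt0.
have s0 : 0 < s by rewrite ltr_wpDr.
have sd0 := sqrtr_ge0 delta; have sdE : Num.sqrt delta ^+ 2 = delta by rewrite sqr_sqrtr// ltW.
set M := Num.max 1 _.
have M1 : 1 <= M by rewrite le_max lexx.
have Mr : u * ln (s / beta) <= M by rewrite le_max lexx orbT.
set c := expR 10; have c0 : 0 < c by exact: expR_gt0.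
have lnc : ln c = 10 by exact: expRK.
have [us|us] := leP (u * beta) (s ^+ 2).
  set r := s / beta in M Mr M1 *.
  have r0 : 0 < r by rewrite divr_gt0.
  have ur : u / beta <= r ^+ 2.
    rewrite /r expr_div_n ler_pdivlMr ?exprn_gt0// expr2 mulrA divfK ?gt_eqF//.
  have h : ln (c * u / beta) <= 10 + 2 * ln r.
    rewrite -mulrA lnM ?posrE ?divr_gt0// lnc lerD2l.
    by rewrite mulr_natl -lnXn// ler_ln ?posrE ?divr_gt0 ?exprn_gt0.
  have h' := ler_wpM2l (ltW u0) h.
  have [r1|r1] := leP 1 (ln r).
    have : u * 1 <= u * ln r by rewrite ler_wpM2l// ltW.
    lra.
  (* Now [ln r < 1], so [u <= u / beta <= r^2 <= expR 2 <= 16], and [u (10 + 2 ln r)] is at most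
     [12 * 16 = 192]. *)
  suff u16 : u <= 16.
    have : u * ln r <= u * 1 by rewrite ler_wpM2l// ltW.
    lra.
  apply: le_trans expR2_le16; apply: (@le_trans _ _ (r ^+ 2)).
    apply: le_trans ur; rewrite ler_pdivlMr// ler_piMr// ltW//.
  rewrite -(@lnK _ r) ?posrE// -expRM_natl ler_expR; lra.
(* If [s >= 1], both entries of [u] are at most [s ^+ 2], against [us], as [beta < 1]. *)
have s1 : s < 1.
  rewrite ltNge; apply/negP => s1.
  have : u <= s ^+ 2.
    have ss : s <= s ^+ 2 by rewrite expr2 ler_peMr// ltW.
    rewrite ge_max; apply/andP; split.
      rewrite -ler_sqr ?nnegrE ?sqr_ge0// sdE; apply: (@le_trans _ _ (s ^+ 2)).
        by apply: le_trans ss; rewrite lerDl.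
      by rewrite ler_pXn2r ?nnegrE ?sqr_ge0// ltW.
    by rewrite ler_pXn2r ?nnegrE// ?(ltW s0)// lerDr ltW.
  move/(le_trans (ler_piMr (ltW u0) (ltW b1))); rewrite leNgt us; exact/negP/negPn.
have d1 : delta < 1 by rewrite (le_lt_trans _ s1)// lerDl.
have g1 : gamma < 1 by rewrite (le_lt_trans _ s1)// lerDr ltW.
have gg : gamma ^+ 2 <= 1 by rewrite expr_le1// ltW.
have u1 : u <= 1.
  by rewrite ge_max gg andbT -sqrtr1 ler_wsqrtr// (ltW d1).
have u2 : u ^+ 2 <= s.
  rewrite /u /Num.max; case: ifP => _; last by rewrite sdE lerDl.
  apply: (@le_trans _ _ (gamma ^+ 2)); first by rewrite expr2 ler_piMr ?sqr_ge0.
  apply: (@le_trans _ _ gamma); first by rewrite expr2 ler_piMr// ltW.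
  by rewrite lerDr ltW.
have u4 : u ^+ 4 <= beta.
  apply: (@le_trans _ _ (s ^+ 2)).
    by rewrite (exprM u 2 2) ler_pXn2r ?nnegrE ?sqr_ge0// ltW.
  exact: le_trans (ltW us) (ler_piMl (ltW b0) u1).
have hu : u * ln u^-1 <= 1.
  have ui0 : 0 < u^-1 by rewrite invr_gt0.
  have := ler_wpM2l (ltW u0) (ln_le_sub1 ui0).
  by rewrite mulrBr divff ?gt_eqF//; lra.
have hb : ln beta^-1 <= 4 * ln u^-1.
  by rewrite mulr_natl -lnXn ?invr_gt0// ler_ln ?posrE ?exprn_gt0 ?invr_gt0//
    exprVn lef_pV2 ?posrE ?exprn_gt0.
have h : ln (c * u / beta) <= 10 + 4 * ln u^-1.
  rewrite lnM ?posrE ?invr_gt0 ?mulr_gt0//; apply: lerD hb.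
  by rewrite -lnc ler_ln ?posrE ?mulr_gt0// ler_piMr// ltW.
have := ler_wpM2l (ltW u0) h; lra.
Qed.

(** The tangent at [w = expR 10 * u / beta] bounds [u ln (4 N / beta)] by [4 N / expR 10 + u ln w].
    The first term is at most [N / 200] since [expR 10 >= 800], the second once
    [N >= 200 u ln w]. *)
Lemma iteration_count : exists N0 : nat, [/\ (4 <= N0)%N,
  N0%:R <= (200 * 192 + 4) * Num.max 1 (u * ln (s / beta)) &
  forall N : nat, (N0 <= N)%N -> 100 * u * ln (4 * N%:R / beta) <= N%:R].
Proof.
have /andP[b0 b1] := beta01; have u0 := rate_gt0.
set c : R := expR 10; have c0 : 0 < c by exact: expR_gt0.
have c800 : 800 <= c by exact: expR10_ge.
set w := c * u / beta.
have w0 : 0 < w by rewrite divr_gt0// mulr_gt0.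
set T := Num.max 0 (200 * (u * ln w)).
have T0 : 0 <= T by rewrite le_max lexx.
(* The shift passes above [T] and reaches the 4 iterations that make [logfactor] at least 2; [ln w]
   may be negative, hence the 0 in [T]. *)
exists (Num.truncn T).+4; split=> //.
  have M1 : 1 <= Num.max 1 (u * ln (s / beta)) by rewrite le_max lexx.
  have hT : T <= 200 * (192 * Num.max 1 (u * ln (s / beta))).
    rewrite ge_max; apply/andP; split; first lra.
    by have := rate_log_le; lra.
  have : (Num.truncn T)%:R <= T by rewrite truncn_le T0.
  rewrite -addn4 natrD => h; lra.
move=> N hN.
have TN : T <= N%:R.
  apply: (@le_trans _ _ (Num.truncn T).+1%:R); first by rewrite ltW// truncnS_gt.
  by rewrite ler_nat; apply: leq_trans hN; rewrite !ltnS leqW// leqW.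
have N0 : 0 < N%:R :> R by rewrite ltr0n (leq_trans _ hN).
have T1 : 200 * (u * ln w) <= T by rewrite le_max lexx orbT.
have x0 : 0 < 4 * N%:R / beta by rewrite divr_gt0// mulr_gt0.
have := ler_wpM2l (ltW u0) (ln_le_affine w0 x0).
have -> : u * (4 * N%:R / beta / w + ln w) = 4 * N%:R / c + u * ln w.
  by rewrite /w; field; rewrite !gt_eqF.
have : 4 * N%:R / c <= N%:R / 200.
  by rewrite ler_pdivrMr//; have := ler_wpM2l (ltW N0) c800; lra.
lra.
Qed.

End Complexity.

Lemma logfactor_ge2 (R : realType) (beta : R) (N : nat) :
  0 < beta < 1 -> (4 <= N)%N -> 2 <= logfactor beta N.
Proof.
move=> /andP[b0 b1] N4; rewrite -[leLHS]expRK ler_ln ?posrE ?expR_gt0//; last first.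
  by rewrite divr_gt0// mulr_gt0// ltr0n (leq_trans _ N4).
apply: le_trans expR2_le16 _; rewrite ler_pdivlMr//.
have : 4 <= N%:R :> R by rewrite (ler_nat R 4).
lra.
Qed.

(** * Probability of success for a fixed number of iterations *)

Section Success.
Context {R : realType}.
Variables (L sigma R0 eps beta : R) (N : nat).
Hypotheses (L0 : 0 < L) (sigma0 : 0 <= sigma) (R00 : 0 < R0).
Hypotheses (beta01 : 0 < beta < 1) (N0 : (0 < N)%N) (l2 : 2 <= logfactor beta N).
Hypothesis acc : 10 * step_param L sigma R0 beta N * L * R0 ^+ 2 <= eps * N%:R ^+ 2.

Lemma clipped_SSTM_success (n : nat) (f : 'rV[R]_n -> R)
    (dXi : measure_display) (Xi : measurableType dXi)
    (D : probability Xi R) (G : 'rV[R]_n -> Xi -> 'rV[R]_n)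
    (x0 xstar : 'rV[R]_n)
    (dOmega : measure_display) (Omega : measurableType dOmega)
    (P : probability Omega R) (xi : nat -> nat -> Omega -> Xi) :
  convex_function [set: convex_lmodType 'rV[R]_n] f ->
  smooth f L -> stochastic_gradient D f sigma G -> minimizer f xstar ->
  norm2 (x0 - xstar) = R0 ->
  iid_samples P D (sample_indices L sigma R0 beta N)
    (fun p : nat * nat => xi p.1 p.2) ->
  ((1 - beta)%:E <=
    P [set w | f (SSTM_output G L sigma R0 beta N x0
                    (fun k i => xi k i w)) - f xstar <= eps]%R)%E.
Proof.
move=> cf fL sgG fmin start iid; have /andP[b0 b1] := beta01.
have [mG _ _] := sgG.
set a := step_param L sigma R0 beta N; set l := logfactor beta N.
set m := batchsize L sigma R0 beta N; set Rc := Cconst R * R0.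
pose B := Rc / (8 * l).
pose st := trajectory G L a B m x0 xi N 0.
have a0 : 0 < a by apply: lt_le_trans (step_param_ge1 L sigma R0 beta N).
have Rc0 : 0 < Rc by exact: Rc_gt0.
have iid' : iid_samples P D (sampled m N) (fun p : nat * nat => xi p.1 p.2) := iid.
have mt : measurable_fun setT st := measurable_trajectory_last L a B x0 mG iid'.
have mV := measurableT_comp (measurable_spotential a xstar fL N) mt.
have outE w : SSTM_output G L sigma R0 beta N x0 (fun k i => xi k i w) = sy (st w).
  by rewrite /sy /st /trajectory /= vtupleK.
have N1 : 0 < N%:R :> R by rewrite ltr0n.
have A0 : 0 < Aseq a L N.
  by rewrite /a AseqE// divr_gt0 ?mulr_gt0// ltr_wpDl.
(* [A_N eps = N (N + 3) eps / (4 a L)] is at least [5 R0^2 / 2 = Rc^2 / 2] by [acc]. *)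
have bad_sub w : eps < f (sy (st w)) - f xstar ->
    Rc ^+ 2 / 2 < spotential f L a xstar N (st w).
  move=> h; rewrite /spotential /potential.
  apply: (@lt_le_trans _ _ (Aseq a L N * (f (sy (st w)) - f xstar))); last first.
    by rewrite lerDl divr_ge0 ?sqr_ge0.
  apply: (@le_lt_trans _ _ (Aseq a L N * eps)); last by rewrite ltr_pM2l.
  rewrite /a AseqE// -/a (sqr_Rc R0) [leRHS]mulrAC ler_pdivlMr ?mulr_gt0//.
  have e0 : 0 < eps.
    rewrite -(pmulr_lgt0 _ (exprn_gt0 2 N1)); apply: lt_le_trans acc.
    by rewrite !mulr_gt0// exprn_gt0.
  have : 0 <= N%:R * eps by rewrite mulr_ge0// ltW.
  have := acc; rewrite -/a; lra.
set E := [set w | _].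
have EE : ~` E `<=` [set w | (Rc ^+ 2 / 2 < spotential f L a xstar N (st w))].
  by move=> w; rewrite /E /= outE => /negP; rewrite -ltNge => /bad_sub.
have mE : measurable E.
  rewrite -[X in measurable X]setTI /E.
  have mf := measurable_smooth fL (vec_measurable_comp mt (@vec_measurable_sy R n)).
  have mg := measurable_funB mf (measurable_cst (f xstar)).
  have mb := measurable_fun_ler mg (measurable_cst eps).
  have := mb measurableT [set true] I; rewrite setTI.
  rewrite [X in measurable X -> _](_ : _ = [set w | f (SSTM_output G L sigma R0 beta N x0
    (fun k i => xi k i w)) - f xstar <= eps]) ?setTI//.
  by apply/seteqP; split=> w /=; rewrite outE.
have tail := potential_tail fL R00 Rc0 (sqr_Rc R0) l2 L0 cf fmin
  (Aseq_ge0 sigma R0 beta N L0) (alpha_gt0 sigma R0 beta N L0)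
  (Lalpha2_le sigma R0 L0 l2) (fun k _ => batchsize_gt0 L sigma R0 beta N k)
  (fun k s _ g => grad_query_le L0 R00 l2 fL fmin g)
  (fun k _ => noise_coef_le L sigma R00 l2 k N0) sgG iid' start N0.
have tailb : expR (- l) <= beta.
  rewrite expRN /l /logfactor lnK ?posrE ?divr_gt0 ?mulr_gt0// invf_div.
  rewrite ler_pdivrMr ?mulr_gt0// ler_peMr ?(ltW b0)//.
  have : 1 <= N%:R :> R by rewrite ler1n.
  lra.
have PE : (P (~` E) <= beta%:E)%E.
  apply: (@le_trans _ _ (expR (- l))%:E); last by rewrite lee_fin.
  apply: le_trans tail; apply: le_measure => //; rewrite inE.
    exact: measurableC.
  rewrite -[X in measurable X]setTI.
  have mb := measurable_fun_ltr (measurable_cst (Rc ^+ 2 / 2)) mV.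
  exact: (mb measurableT [set true] _).
rewrite -[E]setCK probability_setC; last exact: measurableC.
by rewrite EFinB leeB.
Qed.

End Success.

(* [K] is the absolute constant hidden by O(.).  A number of iterations is at
   least 1, whereas [complexity] tends to 0, or is negative, for large [eps];
   hence the bound by max(1, complexity). *)
Theorem corollaryF3 :
  exists K : nat, forall (R : realType) (L sigma R0 eps beta : R),
    0 < L -> 0 <= sigma -> 0 < R0 -> 0 < eps -> 0 < beta < 1 ->
  exists N0 : nat,
    [/\ (1 <= N0)%N /\ 2 <= ln (4 * N0%:R / beta),
        N0%:R <= K%:R * Num.max 1 (complexity L sigma R0 eps beta),
        (oracle_calls L sigma R0 beta N0)%:R
          <= K%:R * Num.max 1 (complexity L sigma R0 eps beta)
      & forall N : nat, (N0 <= N)%N ->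
        forall (n : nat) (f : 'rV[R]_n -> R)
          (dXi : measure_display) (Xi : measurableType dXi)
          (D : probability Xi R) (G : 'rV[R]_n -> Xi -> 'rV[R]_n)
          (x0 xstar : 'rV[R]_n)
          (dOmega : measure_display) (Omega : measurableType dOmega)
          (P : probability Omega R) (xi : nat -> nat -> Omega -> Xi),
        convex_function [set: convex_lmodType 'rV[R]_n] f ->
        smooth f L ->
        stochastic_gradient D f sigma G ->
        minimizer f xstar ->
        norm2 (x0 - xstar) = R0 ->
        iid_samples P D (sample_indices L sigma R0 beta N)
          (fun p : nat * nat => xi p.1 p.2) ->
        ((1 - beta)%:E <=
          P [set w | f (SSTM_output G L sigma R0 beta N x0
                          (fun k i => xi k i w)) - f xstar <= eps]%R)%E].
Proof.
have [c cE] : exists c : nat, forall R : realType, c%:R = 200 * 192 + 4 :> R.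
  by exists (200 * 192 + 4)%N => R; rewrite natrD natrM.
have [c' c'E] : exists c : nat, forall R : realType, c%:R = 2300 :> R by exists 2300%N.
(* [c] serves the iterations and [c' * c] the oracle calls; this constant dominates both. *)
exists ((c' + 1) * c)%N => R L sigma R0 eps beta L0 sigma0 R00 eps0 beta01.
rewrite natrM natrD.
set delta := L * R0 ^+ 2 / eps; set gamma := sigma * R0 / eps.
have delta0 : 0 < delta by rewrite divr_gt0// mulr_gt0// exprn_gt0.
have gamma0 : 0 <= gamma by rewrite divr_ge0 ?mulr_ge0// ltW.
have [N0 [N4 N0le N0acc]] := iteration_count delta0 gamma0 beta01.
rewrite -cE in N0le.
have /andP[b0 b1] := beta01.
have complexityE : complexity L sigma R0 eps beta =
    Num.max (Num.sqrt delta) (gamma ^+ 2) * ln ((delta + gamma) / beta).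
  rewrite /complexity; congr (Num.max _ _ * ln _).
    by rewrite /gamma !exprMn exprVn.
  by rewrite /delta /gamma; field; rewrite !gt_eqF.
rewrite complexityE; set u := Num.max (Num.sqrt _) _ in N0le N0acc *.
set M := Num.max 1 (u * _) in N0le *.
have M1 : 1 <= M by rewrite le_max lexx.
exists N0; split.
- by split; [exact: leq_trans N4|exact: logfactor_ge2].
- apply: le_trans N0le _; rewrite -mulrA mulrDl mul1r lerDr mulr_ge0//.
  by rewrite mulr_ge0// (le_trans ler01 M1).
- apply: le_trans (oracle_calls_le L0 sigma0 R00 (logfactor_ge2 beta01 N4)) _.
  rewrite -c'E -mulrA; apply: ler_pM => //; first by rewrite lerDl.
move=> N NN; move: (leq_trans N4 NN) => {}N4.
have N1 : (0 < N)%N by exact: leq_trans N4.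
apply: clipped_SSTM_success => //; first exact: logfactor_ge2.
apply: (@accuracy _ L sigma R0 beta N L0 sigma0 R00 (logfactor_ge2 beta01 N4) eps u) => //.
- have u1 : Num.sqrt delta <= u by rewrite le_max lexx.
  rewrite -/delta -(sqr_sqrtr (ltW delta0)) ler_pXn2r ?nnegrE ?sqrtr_ge0//.
  exact: le_trans (sqrtr_ge0 _) u1.
- exact: ltW (rate_gt0 gamma delta0).
- by rewrite -exprMn -expr_div_n -/gamma le_max lexx orbT.
- exact: N0acc.
Qed.
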